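(* Let $\mathbb{K}=\mathbb{R}$ or $\mathbb{C}$, let $(X,B)\in\mathbb{K}^{n\times p}\times\mathbb{K}^{n\times p}$, and let $\mathbb{S}\in\{\mathsf{sym},\mathsf{skew\mbox{-}sym},\mathsf{Herm}\}$. Suppose that $\mathrm{rank}(X)=r$ and consider the singular value decomposition $X=U\Sigma V^H$. Partition $U=[U_1\ U_2]$ and $V=[V_1\ V_2]$, where $U_1\in\mathbb{K}^{n\times r}$ and $V_1\in\mathbb{K}^{p\times r}$. Let $\Sigma_1:=\Sigma(1:r,1:r)=\mathrm{diag}(\sigma_1,\dots,\sigma_r)$. Let $D\in\mathbb{C}^{r\times r}$ be given by $D_{ij}:=\dfrac{1}{\sigma_i^2+\sigma_j^2}$, let $\circ$ denote the Hadamard (entrywise) product, and write $$E_\pm^T:=D\circ(\Sigma_1U_1^TBV_1\pm V_1^TB^TU_1\Sigma_1),\qquad E_+^H:=D\circ(\Sigma_1U_1^HBV_1+V_1^HB^HU_1\Sigma_1),$$ $$\mathcal{F}_\pm^T(X,B):=\overline{U}_1E_\pm^TU_1^H\pm(BX^\dagger)^T(I-XX^\dagger)+(I-XX^\dagger)^TBX^\dagger,$$ $$\mathcal{F}_+^H(X,B):=U_1E_+^HU_1^H+(BX^\dagger)^H(I-XX^\dagger)+(I-XX^\dagger)^HBX^\dagger.$$ (In $E_\pm^T$, $E_+^H$, $\mathcal{F}_\pm^T$, $\mathcal{F}_+^H$ the superscripts are labels only.) 1. (Frobenius norm) With $\|\cdot\|=\|\cdot\|_F$ in the definition of $\sigma^{\mathbb{S}}$,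 $$\sigma^{\mathbb{S}}(X,B)=\begin{cases}\sqrt{\|E_+^T\|_F^2+2\|U_2^TBV_1\Sigma_1^{-1}\|_F^2}, & \text{if } \mathbb{S}=\mathsf{sym},\\ \sqrt{\|E_+^H\|_F^2+2\|U_2^HBV_1\Sigma_1^{-1}\|_F^2}, & \text{if } \mathbb{S}=\mathsf{Herm},\\ \sqrt{\|E_-^T\|_F^2+2\|U_2^TBV_1\Sigma_1^{-1}\|_F^2}, & \text{if } \mathbb{S}=\mathsf{skew\mbox{-}sym}.\end{cases}$$ There is a unique $A_o\in\mathbb{S}$ such that $\|A_oX-B\|_F=\rho^{\mathbb{S}}(X,B)$ and $\|A_o\|_F=\sigma^{\mathbb{S}}(X,B)$, and it is given by $$A_o=\begin{cases}\mathcal{F}_+^T(X,B), & \text{if } \mathbb{S}=\mathsf{sym},\\ \mathcal{F}_-^T(X,B), & \text{if } \mathbb{S}=\mathsf{skew\mbox{-}sym},\\ \mathcal{F}_+^H(X,B), & \text{if } \mathbb{S}=\mathsf{Herm}.\end{cases}$$ 2. (Spectral norm) With $\|\cdot\|=\|\cdot\|_2$ in the definition of $\sigma^{\mathbb{S}}$, $$\sigma^{\mathbb{S}}(X,B)=\begin{cases}\left\|\begin{bmatrix}E_+^T\\ U_2^TBV_1\Sigma_1^{-1}\end{bmatrix}\right\|_2=:\mu_1, & \text{if } \mathbb{S}=\mathsf{sym},\\[2ex] \left\|\begin{bmatrix}E_+^H\\ U_2^HBV_1\Sigma_1^{-1}\end{bmatrix}\right\|_2=:\mu_1, & \text{if }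 \mathbb{S}=\mathsf{Herm},\\[2ex] \left\|\begin{bmatrix}E_-^T\\ U_2^TBV_1\Sigma_1^{-1}\end{bmatrix}\right\|_2=:\mu_2, & \text{if } \mathbb{S}=\mathsf{skew\mbox{-}sym}.\end{cases}$$ Further, $A_o\in\mathbb{S}$ satisfies $\|A_oX-B\|_F=\rho^{\mathbb{S}}(X,B)$ and $\|A_o\|_2=\sigma^{\mathbb{S}}(X,B)$ if and only if $A_o$ is of the form $$A_o=\begin{cases}\mathcal{F}_+^T(X,B)-(I-XX^\dagger)^TK\,\overline{E_+^T}\,K^T(I-XX^\dagger)+\phi(Z), & \text{if } \mathbb{S}=\mathsf{sym},\\ \mathcal{F}_-^T(X,B)-(I-XX^\dagger)^TK\,\overline{E_-^T}\,K^T(I-XX^\dagger)+\phi(Z), & \text{if } \mathbb{S}=\mathsf{skew\mbox{-}sym},\\ \mathcal{F}_+^H(X,B)-(I-XX^\dagger)^HK\,E_+^H\,K^H(I-XX^\dagger)+\phi(Z), & \text{if } \mathbb{S}=\mathsf{Herm},\end{cases}$$ where $$K=\begin{cases}BX^\dagger U_1[\mu_1^2I-\overline{E_+^T}\,E_+^T]^{-1/2}, & \text{if } \mathbb{S}=\mathsf{sym},\\ BX^\dagger U_1[\mu_2^2I-\overline{E_-^T}\,E_-^T]^{-1/2}, & \text{if } \mathbb{S}=\mathsf{skew\mbox{-}sym},\\ BX^\dagger U_1[\mu_1^2I-E_+^H\,E_+^H]^{-1/2}, & \text{if } \mathbb{S}=\mathsf{Herm},\end{cases}$$ and $$\phi(Z)=\begin{cases}\mu_1\overline{U}_2[I-U_2^TKK^H\overline{U}_2]^{1/2}Z[I-U_2^H\overline{K}K^TU_2]^{1/2}U_2^H,\quad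 Z=Z^T,\ \|Z\|_2\le1, & \text{if } \mathbb{S}=\mathsf{sym},\\ \mu_2\overline{U}_2[I+U_2^TKK^H\overline{U}_2]^{1/2}Z[I+U_2^H\overline{K}K^TU_2]^{1/2}U_2^H,\quad Z=-Z^T,\ \|Z\|_2\le1, & \text{if } \mathbb{S}=\mathsf{skew\mbox{-}sym},\\ \mu_1U_2[I-U_2^HKK^HU_2]^{1/2}Z[I-U_2^HKK^HU_2]^{1/2}U_2^H,\quad Z=Z^H,\ \|Z\|_2\le1, & \text{if } \mathbb{S}=\mathsf{Herm}.\end{cases}$$
   Context: $Y^T$, $Y^H$, $\overline{Y}$ and $Y^\dagger$ denote the transpose, conjugate transpose, complex conjugate and Moore-Penrose pseudo-inverse of a matrix $Y$; $\|\cdot\|_F$ is the Frobenius norm and $\|\cdot\|_2$ the spectral norm. In the singular value decomposition $X=U\Sigma V^H$, $U$ ($n\times n$) and $V$ ($p\times p$) are unitary and $\sigma_1,\dots,\sigma_r>0$ are the nonzero singular values of $X$. The inverses in the expression of $K$ are replaced by Moore-Penrose pseudo-inverses when the matrices are singular. Classes of matrices: $\mathsf{sym}:=\{A\in\mathbb{K}^{n\times n}:A^T=A\}$, $\mathsf{skew\mbox{-}sym}:=\{A\in\mathbb{K}^{n\times n}:A^T=-A\}$, $\mathsf{Herm}:=\{A\in\mathbb{C}^{n\times n}:A^H=A\}$. For such a class $\mathbb{S}$, $\rho^{\mathbb{S}}(X,B):=\inf\{\|AX-B\|_F: A\in\mathbb{S}\}$ and $\sigma^{\mathbb{S}}(X,B):=\inf\{\|A\|: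 A\in\mathbb{S},\ \|AX-B\|_F=\rho^{\mathbb{S}}(X,B)\}$, where $\|\cdot\|$ is either the Frobenius norm or the spectral norm, as specified.
   Formalization: E is taken as D∘(U1*BV1Σ1 ± Σ1V1*B*U1) ( * = T or H) instead of the printed placement of Σ1; for skew-sym, K uses μ2²I + conj(E)E and φ has minus signs in both square roots. As printed the claim fails, e.g. sym with X=diag(2,1), B=[0 1;2 0]. *)

(* Defs.v *)
From HB Require Import structures.
From mathcomp Require Import all_boot all_order all_algebra.
From mathcomp Require Import boolp classical_sets reals.
From mathcomp Require Import complex.

Set Implicit Arguments.
Unset Strict Implicit.
Unset Printing Implicit Defensive.

Import Order.TTheory GRing.Theory Num.Theory.
Local Open Scope ring_scope.
Local Open Scope sesquilinear_scope.
Local Open Scope complex_scope.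

(* All matrices live over the complex numbers R[i], where R : realType is the
   real line. The case K = R is the case of matrices with real entries. *)
Inductive scalars := RealScalars | ComplexScalars.

Inductive structure := Sym | SkewSym | Herm.

Definition entries_in (R : realType) (K : scalars) (m n : nat)
    (A : 'M[R[i]]_(m, n)) : bool :=
  match K with
  | RealScalars => A \is a realmx
  | ComplexScalars => true
  end.

(* Herm is a class of complex matrices whatever K is. *)
Definition in_class (R : realType) (K : scalars) (S : structure) (n : nat)
    (A : 'M[R[i]]_n) : bool :=
  match S with
  | Sym => entries_in K A && (A \is symmetricmx)
  | SkewSym => entries_in K A && (A \is skewmx)
  | Herm => A \is hermsymmx
  end.

Definition fro_norm (R : realType) (m n : nat) (A : 'M[R[i]]_(m, n)) : R :=
  Num.sqrt (\sum_i \sum_j ComplexField.Normc.normc (A i j) ^+ 2).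

(* On column vectors fro_norm is the Euclidean norm. The unit ball (rather than
   the sphere) makes this 0 on matrices with no column. *)
Definition spec_norm (R : realType) (m n : nat) (A : 'M[R[i]]_(m, n)) : R :=
  sup [set fro_norm (A *m x) | x in [set x : 'cV[R[i]]_n | fro_norm x <= 1]].

Definition is_mpinv (R : realType) (m n : nat) (A : 'M[R[i]]_(m, n))
    (Y : 'M[R[i]]_(n, m)) : Prop :=
  [/\ A *m Y *m A = A, Y *m A *m Y = Y,
      (A *m Y)^t* = A *m Y & (Y *m A)^t* = Y *m A].

(* The Moore-Penrose pseudo-inverse; mathcomp's pinvmx is another, non-canonical
   generalized inverse. *)
Definition mpinv (R : realType) (m n : nat) (A : 'M[R[i]]_(m, n))
    : 'M[R[i]]_(n, m) :=
  xget 0 [set Y | is_mpinv A Y].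

Definition psd (R : realType) (n : nat) (A : 'M[R[i]]_n) : Prop :=
  A \is hermsymmx /\ forall x : 'cV[R[i]]_n, 0 <= (x^t* *m A *m x) 0 0.

(* The square root M^(1/2) of a positive semidefinite M. *)
Definition psd_sqrt (R : realType) (n : nat) (M : 'M[R[i]]_n) : 'M[R[i]]_n :=
  xget 0 [set Q | psd Q /\ Q *m Q = M].

Definition rho (R : realType) (K : scalars) (S : structure) (n p : nat)
    (X B : 'M[R[i]]_(n, p)) : R :=
  inf [set fro_norm (A *m X - B) | A in [set A : 'M[R[i]]_n | in_class K S A]].

Definition procrustes_sol (R : realType) (K : scalars) (S : structure)
    (n p : nat) (X B : 'M[R[i]]_(n, p)) (A : 'M[R[i]]_n) : Prop :=
  in_class K S A /\ fro_norm (A *m X - B) = rho K S X B.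

Definition sigma (R : realType) (K : scalars) (S : structure) (n p : nat)
    (nrm : 'M[R[i]]_n -> R) (X B : 'M[R[i]]_(n, p)) : R :=
  inf [set nrm A | A in [set A | procrustes_sol K S X B A]].

(* 0 < z in R[i] says that z is real and positive. *)
Definition is_svd (R : realType) (K : scalars) (r n p : nat)
    (X : 'M[R[i]]_(n, p)) (U : 'M[R[i]]_n) (Sg : 'M[R[i]]_(n, p))
    (V : 'M[R[i]]_p) : Prop :=
  [/\ entries_in K U && (U \is unitarymx), entries_in K V && (V \is unitarymx),
      X = U *m Sg *m V^t*,
      forall (i : 'I_n) (j : 'I_p), i <> j :> nat -> Sg i j = 0 &
      forall (i : 'I_n) (j : 'I_p), i = j :> nat ->
        ((i < r)%N -> 0 < Sg i j) /\ ((r <= i)%N -> Sg i j = 0)].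

Lemma mxrank_le_row (F : fieldType) (n p r : nat) (X : 'M[F]_(n, p)) :
  \rank X = r -> (r <= n)%N.
Proof. by move=> <-; exact: rank_leq_row. Qed.

Lemma mxrank_le_col (F : fieldType) (n p r : nat) (X : 'M[F]_(n, p)) :
  \rank X = r -> (r <= p)%N.
Proof. by move=> <-; exact: rank_leq_col. Qed.

Definition first_cols (T : Type) (m n r : nat) (hr : (r <= n)%N)
    (M : 'M[T]_(m, n)) : 'M[T]_(m, r) :=
  colsub (widen_ord hr) M.

Definition last_cols (T : Type) (m n r : nat) (hr : (r <= n)%N)
    (M : 'M[T]_(m, n)) : 'M[T]_(m, n - r) :=
  colsub (fun j => cast_ord (subnKC hr) (rshift r j)) M.

Definition lead_block (T : Type) (n p r : nat) (hn : (r <= n)%N)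
    (hp : (r <= p)%N) (M : 'M[T]_(n, p)) : 'M[T]_r :=
  mxsub (widen_ord hn) (widen_ord hp) M.

Definition hadamard (R : realType) (m n : nat) (A B : 'M[R[i]]_(m, n)) :=
  map2_mx *%R A B.

Definition Dmx (R : realType) (r : nat) (S1 : 'M[R[i]]_r) : 'M[R[i]]_r :=
  \matrix_(i, j) (S1 i i ^+ 2 + S1 j j ^+ 2)^-1.

(* E is the structured minimizer Y of ||Y S1 - U1^T B V1||_F, resp. of
   ||Y S1 - U1^H B V1||_F, so it solves the normal equation
     Y S1^2 + S1^2 Y = U1^T B V1 S1 +- S1 V1^T B^T U1,
   resp. its ^H analogue. This fixes the side of S1 in both summands. The source
   prints S1 U1^T B V1 +- V1^T B^T U1 S1, which is not the minimizer: take
   X = diag(1, 2), U1 = V1 = I and B = A X with A = [0 1; 1 0]. *)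
Definition ET (R : realType) (e : R[i]) (n p r : nat) (B : 'M[R[i]]_(n, p))
    (U1 : 'M[R[i]]_(n, r)) (V1 : 'M[R[i]]_(p, r)) (S1 : 'M[R[i]]_r) :=
  hadamard (Dmx S1)
    (U1^T *m B *m V1 *m S1 + e *: (S1 *m V1^T *m B^T *m U1)).

Definition EH (R : realType) (n p r : nat) (B : 'M[R[i]]_(n, p))
    (U1 : 'M[R[i]]_(n, r)) (V1 : 'M[R[i]]_(p, r)) (S1 : 'M[R[i]]_r) :=
  hadamard (Dmx S1)
    (U1^t* *m B *m V1 *m S1 + S1 *m V1^t* *m B^t* *m U1).

Definition Emx (R : realType) (S : structure) (n p r : nat)
    (B : 'M[R[i]]_(n, p)) (U1 : 'M[R[i]]_(n, r)) (V1 : 'M[R[i]]_(p, r))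
    (S1 : 'M[R[i]]_r) : 'M[R[i]]_r :=
  match S with
  | Sym => ET 1 B U1 V1 S1
  | SkewSym => ET (- 1) B U1 V1 S1
  | Herm => EH B U1 V1 S1
  end.

(* U2^T B V1 S1^-1, resp. U2^H B V1 S1^-1 *)
Definition Cmx (R : realType) (S : structure) (n p r m : nat)
    (B : 'M[R[i]]_(n, p)) (U2 : 'M[R[i]]_(n, m)) (V1 : 'M[R[i]]_(p, r))
    (S1 : 'M[R[i]]_r) : 'M[R[i]]_(m, r) :=
  match S with
  | Sym | SkewSym => U2^T *m B *m V1 *m invmx S1
  | Herm => U2^t* *m B *m V1 *m invmx S1
  end.

(* I - X X^dagger *)
Definition coproj (R : realType) (n p : nat) (X : 'M[R[i]]_(n, p))
    : 'M[R[i]]_n :=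
  1%:M - X *m mpinv X.

Definition FT (R : realType) (e : R[i]) (n p r : nat)
    (X B : 'M[R[i]]_(n, p)) (U1 : 'M[R[i]]_(n, r)) (E : 'M[R[i]]_r)
    : 'M[R[i]]_n :=
  map_mx Num.conj U1 *m E *m U1^t* + e *: ((B *m mpinv X)^T *m coproj X)
  + (coproj X)^T *m B *m mpinv X.

Definition FH (R : realType) (n p r : nat)
    (X B : 'M[R[i]]_(n, p)) (U1 : 'M[R[i]]_(n, r)) (E : 'M[R[i]]_r)
    : 'M[R[i]]_n :=
  U1 *m E *m U1^t* + (B *m mpinv X)^t* *m coproj X
  + (coproj X)^t* *m B *m mpinv X.

Definition Fmx (R : realType) (S : structure) (n p r : nat)
    (X B : 'M[R[i]]_(n, p)) (U1 : 'M[R[i]]_(n, r)) (E : 'M[R[i]]_r)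
    : 'M[R[i]]_n :=
  match S with
  | Sym => FT 1 X B U1 E
  | SkewSym => FT (- 1) X B U1 E
  | Herm => FH X B U1 E
  end.

(* The matrix under the square root is mu^2 I - E^H E, and E^H = - conj(E) for a
   skew-symmetric E: this gives the sign in that case (the source prints a minus
   sign there, with a plus sign in both square roots of phi). *)
Definition Kmx (R : realType) (S : structure) (n p r : nat)
    (X B : 'M[R[i]]_(n, p)) (U1 : 'M[R[i]]_(n, r)) (E : 'M[R[i]]_r) (mu : R)
    : 'M[R[i]]_(n, r) :=
  B *m mpinv X *m U1 *m
  mpinv (psd_sqrt
    match S with
    | Sym => (mu ^+ 2)%:C%:M - map_mx Num.conj E *m E
    | SkewSym => (mu ^+ 2)%:C%:M + map_mx Num.conj E *m E
    | Herm => (mu ^+ 2)%:C%:M - E *m E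
    end).

Definition central (R : realType) (S : structure) (n p r : nat)
    (X : 'M[R[i]]_(n, p)) (E : 'M[R[i]]_r) (K : 'M[R[i]]_(n, r))
    : 'M[R[i]]_n :=
  match S with
  | Sym | SkewSym => (coproj X)^T *m K *m map_mx Num.conj E *m K^T *m coproj X
  | Herm => (coproj X)^t* *m K *m E *m K^t* *m coproj X
  end.

Definition phi (R : realType) (S : structure) (n r m : nat) (mu : R)
    (U2 : 'M[R[i]]_(n, m)) (K : 'M[R[i]]_(n, r)) (Z : 'M[R[i]]_m)
    : 'M[R[i]]_n :=
  match S with
  | Sym | SkewSym =>
      mu%:C *: (map_mx Num.conj U2
        *m psd_sqrt (1%:M - U2^T *m K *m K^t* *m map_mx Num.conj U2)
        *m Z
        *m psd_sqrt (1%:M - U2^t* *m map_mx Num.conj K *m K^T *m U2)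
        *m U2^t*)
  | Herm =>
      mu%:C *: (U2
        *m psd_sqrt (1%:M - U2^t* *m K *m K^t* *m U2)
        *m Z
        *m psd_sqrt (1%:M - U2^t* *m K *m K^t* *m U2)
        *m U2^t*)
  end.

(* Main.v *)
(* Write A^* for A^T or A^H according to the structure, so that the class is
   A^* = e A with e = 1 or -1. In the bases given by U and conj(U), or by U alone
   for Herm, the Procrustes problem only involves the first r columns of A: the
   residual is minimal exactly when A has the block form [E, e C^*; C, D], where
   E solves the normal equation and D is any matrix of the class. The squared
   Frobenius norm is |E|^2 + 2|C|^2 + |D|^2, so D = 0 is the unique minimizer.
   The spectral norm is at least mu = |[E; C]|, and the D attaining mu are given
   by the theorem of Parrott and of Davis, Kahan and Weinberger. That theorem is
   proved by two applications of Douglas' factorization lemma: with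
   Q = (mu^2 - E^H E)^(1/2), Q' = (mu^2 - E E^H)^(1/2), C = k Q and e C^* = Q' L,
   mu^2 I minus the Gram matrix of the rows of [E; C] equals R R^H with
   R = [Q', 0; - k E^H, mu (I - k k^H)^(1/2)], so the second block column is
   R W for a contraction W. Averaging the resulting parameter Z over the
   symmetries of the class puts Z in the class. *)
Require Import Defs.
From HB Require Import structures.
From mathcomp Require Import all_boot all_order all_algebra.
From mathcomp Require Import boolp classical_sets reals.
From mathcomp Require Import complex.
From mathcomp Require Import ring lra.

Set Implicit Arguments.
Unset Strict Implicit.
Unset Printing Implicit Defensive.

Import Order.TTheory GRing.Theory Num.Theory.
Local Open Scope ring_scope.
Local Open Scope sesquilinear_scope.
Local Open Scope complex_scope.

(** * Structured adjoints of complex matrices *)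

Section Adjoint.
Variable R : realType.
Implicit Types (m n p : nat) (h : bool).

(* One operation for the three structures: the transpose for sym and skew-sym,
   the conjugate transpose for Herm. *)
Definition sadj h m n (A : 'M[R[i]]_(m, n)) : 'M[R[i]]_(n, m) :=
  if h then A^t* else A^T.

Lemma sadjK h m n (A : 'M[R[i]]_(m, n)) : sadj h (sadj h A) = A.
Proof. by case: h; rewrite /sadj ?trmxCK ?trmxK. Qed.

Lemma sadjM h m n p (A : 'M[R[i]]_(m, n)) (B : 'M[R[i]]_(n, p)) :
  sadj h (A *m B) = sadj h B *m sadj h A.
Proof. by case: h; rewrite /sadj trmx_mul ?map_mxM. Qed.

Lemma sadjD h m n (A B : 'M[R[i]]_(m, n)) : sadj h (A + B) = sadj h A + sadj h B.
Proof. by case: h; rewrite /sadj linearD ?map_mxD. Qed.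

Lemma sadjN h m n (A : 'M[R[i]]_(m, n)) : sadj h (- A) = - sadj h A.
Proof. by case: h; rewrite /sadj linearN ?map_mxN. Qed.

Lemma sadjB h m n (A B : 'M[R[i]]_(m, n)) : sadj h (A - B) = sadj h A - sadj h B.
Proof. by rewrite sadjD sadjN. Qed.

Lemma sadj0 h m n : sadj h (0 : 'M[R[i]]_(m, n)) = 0.
Proof. by case: h; rewrite /sadj trmx0 ?map_mx0. Qed.

Lemma conjCr (a : R) : Num.conj a%:C = a%:C.
Proof. exact: conjc_real. Qed.

Lemma sadjZ h (a : R) m n (A : 'M[R[i]]_(m, n)) :
  sadj h (a%:C *: A) = a%:C *: sadj h A.
Proof. by case: h; rewrite /sadj linearZ ?map_mxZ //= conjCr. Qed.

Lemma sadj_scalar h (a : R) n : sadj h (a%:C%:M : 'M[R[i]]_n) = a%:C%:M.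
Proof. by case: h; rewrite /sadj tr_scalar_mx // map_scalar_mx /= conjCr. Qed.

Lemma sadj1 h n : sadj h (1%:M : 'M[R[i]]_n) = 1%:M.
Proof. exact: (sadj_scalar h 1). Qed.

Lemma sadj_conj h m n (A : 'M[R[i]]_(m, n)) :
  sadj h (map_mx Num.conj A) = map_mx Num.conj (sadj h A).
Proof. by case: h; rewrite /sadj map_trmx. Qed.

Lemma sadjCE m n (A : 'M[R[i]]_(m, n)) : sadj true A = A^t*.
Proof. by []. Qed.

Lemma sadj_sadjC h m n (A : 'M[R[i]]_(m, n)) :
  sadj h (sadj true A) = sadj true (sadj h A).
Proof. by case: h => //; rewrite /sadj map_trmx. Qed.

Lemma conjMK m n (A : 'M[R[i]]_(m, n)) : map_mx Num.conj (map_mx Num.conj A) = A.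
Proof. by apply/matrixP => i j; rewrite !mxE conjCK. Qed.

(** Conjugation is the composite of the two adjoints, so facts about [sadj] carry over to it. *)
Lemma conj_sadj m n (A : 'M[R[i]]_(m, n)) :
  map_mx Num.conj A = sadj true (sadj false A).
Proof. by rewrite /sadj trmxK. Qed.

Lemma sadj_row_mx h m n1 n2 (A : 'M[R[i]]_(m, n1)) (B : 'M[R[i]]_(m, n2)) :
  sadj h (row_mx A B) = col_mx (sadj h A) (sadj h B).
Proof. by case: h; rewrite /sadj tr_row_mx ?map_col_mx. Qed.

Lemma sadj_col_mx h m1 m2 n (A : 'M[R[i]]_(m1, n)) (B : 'M[R[i]]_(m2, n)) :
  sadj h (col_mx A B) = row_mx (sadj h A) (sadj h B).
Proof. by case: h; rewrite /sadj tr_col_mx ?map_row_mx. Qed.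

Lemma sadj_block_mx h m1 m2 n1 n2 (A : 'M[R[i]]_(m1, n1))
    (B : 'M[R[i]]_(m1, n2)) (C : 'M[R[i]]_(m2, n1)) (D : 'M[R[i]]_(m2, n2)) :
  sadj h (block_mx A B C D)
    = block_mx (sadj h A) (sadj h C) (sadj h B) (sadj h D).
Proof. by case: h; rewrite /sadj tr_block_mx ?map_block_mx. Qed.

Lemma sadjE h m n (A : 'M[R[i]]_(m, n)) : sadj h A = if h then A^t* else A^T.
Proof. by []. Qed.

End Adjoint.

Opaque sadj.
Arguments sadj : simpl never.

Notation "A ^H" := (sadj true A) (at level 8, format "A ^H") : ring_scope.

(** * The real inner product behind the Frobenius norm *)

Section RealInner.
Variable R : realType.
Implicit Types (m n p : nat) (h : bool).

(** Taking the real part makes transposition and conjugation preserve the form as well, so that the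
    three structures can share one argument. *)
Definition redot m n (A B : 'M[R[i]]_(m, n)) : R := complex.Re (\tr (A^H *m B)).

Lemma ReD (x y : R[i]) : complex.Re (x + y) = complex.Re x + complex.Re y.
Proof. by case: x; case: y. Qed.

Lemma ReN (x : R[i]) : complex.Re (- x) = - complex.Re x.
Proof. by case: x. Qed.

Lemma ReZ (a : R) (x : R[i]) : complex.Re (a%:C * x) = a * complex.Re x.
Proof. by case: x => u v /=; rewrite mul0r subr0. Qed.

Lemma ReJ (x : R[i]) : complex.Re (Num.conj x) = complex.Re x.
Proof. by case: x. Qed.

Lemma redotDr m n (A B C : 'M[R[i]]_(m, n)) :
  redot A (B + C) = redot A B + redot A C.
Proof. by rewrite /redot mulmxDr mxtraceD ReD. Qed.

Lemma redotDl m n (A B C : 'M[R[i]]_(m, n)) :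
  redot (A + B) C = redot A C + redot B C.
Proof. by rewrite /redot sadjD mulmxDl mxtraceD ReD. Qed.

Lemma redotNr m n (A B : 'M[R[i]]_(m, n)) : redot A (- B) = - redot A B.
Proof. by rewrite /redot mulmxN raddfN /= ReN. Qed.

Lemma redotNl m n (A B : 'M[R[i]]_(m, n)) : redot (- A) B = - redot A B.
Proof. by rewrite /redot sadjN mulNmx raddfN /= ReN. Qed.

Lemma redotZr (a : R) m n (A B : 'M[R[i]]_(m, n)) :
  redot A (a%:C *: B) = a * redot A B.
Proof. by rewrite /redot -scalemxAr mxtraceZ ReZ. Qed.

Lemma redotZl (a : R) m n (A B : 'M[R[i]]_(m, n)) :
  redot (a%:C *: A) B = a * redot A B.
Proof. by rewrite /redot sadjZ -scalemxAl mxtraceZ ReZ. Qed.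

Lemma redot0r m n (A : 'M[R[i]]_(m, n)) : redot A 0 = 0.
Proof. by rewrite /redot mulmx0 mxtrace0. Qed.

Lemma redot0l m n (A : 'M[R[i]]_(m, n)) : redot 0 A = 0.
Proof. by rewrite /redot sadj0 mul0mx mxtrace0. Qed.

Lemma mxtrace_conj n (A : 'M[R[i]]_n) : \tr (map_mx Num.conj A) = Num.conj (\tr A).
Proof. by rewrite /mxtrace rmorph_sum; apply: eq_bigr => i _; rewrite mxE. Qed.

Lemma Re_mxtrace_sadj h n (A : 'M[R[i]]_n) :
  complex.Re (\tr (sadj h A)) = complex.Re (\tr A).
Proof. by case: h; rewrite sadjE ?mxtrace_conj ?ReJ mxtrace_tr. Qed.

Lemma redotC m n (A B : 'M[R[i]]_(m, n)) : redot A B = redot B A.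
Proof. by rewrite /redot -(Re_mxtrace_sadj true) sadjM sadjK. Qed.

Lemma redot_mull m n p (M : 'M[R[i]]_(m, n)) (A : 'M[R[i]]_(n, p)) B :
  redot (M *m A) B = redot A (M^H *m B).
Proof. by rewrite /redot sadjM mulmxA. Qed.

Lemma redot_mulr m n p (A : 'M[R[i]]_(m, n)) (M : 'M[R[i]]_(n, p)) B :
  redot (A *m M) B = redot A (B *m M^H).
Proof. by rewrite /redot sadjM -mulmxA mxtrace_mulC mulmxA. Qed.

Lemma redot_sadj h m n (A B : 'M[R[i]]_(m, n)) :
  redot (sadj h A) (sadj h B) = redot A B.
Proof.
by rewrite /redot -sadj_sadjC -sadjM Re_mxtrace_sadj mxtrace_mulC.
Qed.

Lemma redot_conj m n (A B : 'M[R[i]]_(m, n)) :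
  redot (map_mx Num.conj A) (map_mx Num.conj B) = redot A B.
Proof. by rewrite !conj_sadj !redot_sadj. Qed.

Definition fro2 m n (A : 'M[R[i]]_(m, n)) : R := redot A A.

Lemma normc2E (x : R[i]) :
  ComplexField.Normc.normc x ^+ 2 = complex.Re (Num.conj x * x).
Proof.
case: x => a b /=; rewrite sqr_sqrtr ?addr_ge0 ?sqr_ge0 //.
by rewrite mulNr opprK !expr2.
Qed.

Lemma fro2E m n (A : 'M[R[i]]_(m, n)) :
  fro2 A = \sum_i \sum_j ComplexField.Normc.normc (A i j) ^+ 2.
Proof.
rewrite /fro2 /redot /mxtrace (big_morph _ ReD erefl) exchange_big /=.
apply: eq_bigr => j _; rewrite mxE (big_morph _ ReD erefl).
by apply: eq_bigr => i _; rewrite normc2E !mxE.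
Qed.

Lemma redotE m n (A B : 'M[R[i]]_(m, n)) :
  redot A B = complex.Re (\tr (A^H *m B)).
Proof. by []. Qed.

Opaque redot.

Lemma fro2_ge0 m n (A : 'M[R[i]]_(m, n)) : 0 <= fro2 A.
Proof. by rewrite fro2E; do 2! apply: sumr_ge0 => ? _; apply: sqr_ge0. Qed.

Lemma fro2_eq0 m n (A : 'M[R[i]]_(m, n)) : fro2 A = 0 -> A = 0.
Proof.
rewrite fro2E => A0; apply/matrixP => i j; rewrite mxE.
have {}A0 := psumr_eq0P (fun i _ => sumr_ge0 _ (fun j _ => sqr_ge0 _)) A0.
have /(_ j isT) := psumr_eq0P (fun j _ => sqr_ge0 _) (A0 i isT).
by move/eqP; rewrite sqrf_eq0 => /eqP /ComplexField.Normc.eq0_normc.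
Qed.

Lemma fro2_0 m n : fro2 (0 : 'M[R[i]]_(m, n)) = 0.
Proof. by rewrite /fro2 redot0l. Qed.

Lemma fro_normE m n (A : 'M[R[i]]_(m, n)) : fro_norm A = Num.sqrt (fro2 A).
Proof. by rewrite fro2E. Qed.

Lemma fro_norm2 m n (A : 'M[R[i]]_(m, n)) : fro_norm A ^+ 2 = fro2 A.
Proof. by rewrite fro_normE sqr_sqrtr ?fro2_ge0. Qed.

Lemma fro_norm_ge0 m n (A : 'M[R[i]]_(m, n)) : 0 <= fro_norm A.
Proof. by rewrite fro_normE sqrtr_ge0. Qed.

Lemma fro2D m n (A B : 'M[R[i]]_(m, n)) :
  fro2 (A + B) = fro2 A + fro2 B + 2 * redot A B.
Proof. rewrite /fro2 redotDl !redotDr [redot B A]redotC.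
move: (redot A A) (redot B B) (redot A B) => a b c; ring. Qed.

Lemma fro2N m n (A : 'M[R[i]]_(m, n)) : fro2 (- A) = fro2 A.
Proof. by rewrite /fro2 redotNl redotNr opprK. Qed.

Lemma fro2B m n (A B : 'M[R[i]]_(m, n)) :
  fro2 (A - B) = fro2 A + fro2 B - 2 * redot A B.
Proof. by rewrite fro2D fro2N redotNr mulrN. Qed.

Lemma fro2Z (a : R) m n (A : 'M[R[i]]_(m, n)) :
  fro2 (a%:C *: A) = a ^+ 2 * fro2 A.
Proof. by rewrite /fro2 redotZl redotZr; ring. Qed.

Lemma fro2_sadj h m n (A : 'M[R[i]]_(m, n)) : fro2 (sadj h A) = fro2 A.
Proof. exact: redot_sadj. Qed.

Lemma fro2_conj m n (A : 'M[R[i]]_(m, n)) : fro2 (map_mx Num.conj A) = fro2 A.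
Proof. exact: redot_conj. Qed.

Lemma fro2_col_mx m1 m2 n (A : 'M[R[i]]_(m1, n)) (B : 'M[R[i]]_(m2, n)) :
  fro2 (col_mx A B) = fro2 A + fro2 B.
Proof.
rewrite !fro2E big_split_ord /=; congr (_ + _); apply: eq_bigr => i _;
by apply: eq_bigr => j _; rewrite ?col_mxEu ?col_mxEd.
Qed.

Lemma fro2_row_mx m n1 n2 (A : 'M[R[i]]_(m, n1)) (B : 'M[R[i]]_(m, n2)) :
  fro2 (row_mx A B) = fro2 A + fro2 B.
Proof.
by rewrite -(fro2_sadj false) sadj_row_mx fro2_col_mx !fro2_sadj.
Qed.

End RealInner.

(** * Operator bounds and the spectral norm *)

Section OpBound.
Variable R : realType.
Implicit Types (m n p : nat) (h : bool) (c : R).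

(** The squared form turns norm estimates into polynomial inequalities between values of [fro2];
    [spec_normP] links it to the supremum. *)
Definition opbound c m n (A : 'M[R[i]]_(m, n)) :=
  forall x : 'cV[R[i]]_n, fro2 (A *m x) <= c ^+ 2 * fro2 x.

(** For [c != 0], expand [0 <= |c^2 y - A A^H y|^2] and bound [|A A^H y|^2] by [c^2 |A^H y|^2];
    dividing by [c^2] leaves the claim. *)
Lemma opbound_sadjC c m n (A : 'M[R[i]]_(m, n)) :
  opbound c A -> opbound c (A^H).
Proof.
move=> hA y; have [/eqP c0|c0] := boolP (c == 0).
  have A0 : A^H *m y = 0.
    have A0 := hA (A^H *m y).
    have {}A0 : fro2 (A *m (A^H *m y)) = 0.
      by apply/eqP; rewrite eq_le fro2_ge0 andbT; move: A0; rewrite c0 expr2 !mul0r.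
    apply: fro2_eq0; rewrite /fro2 redot_mull sadjK.
    by rewrite (fro2_eq0 A0) redot0r.
  by rewrite A0 fro2_0 mulr_ge0 ?sqr_ge0 ?fro2_ge0.
have := fro2_ge0 ((c ^+ 2)%:C *: y - A *m (A^H *m y)).
rewrite fro2B fro2Z redotZl.
have -> : redot y (A *m (A^H *m y)) = fro2 (A^H *m y).
  by rewrite /fro2 redot_mull sadjK.
have := hA (A^H *m y); set v := fro2 (A^H *m y); set w := fro2 (A *m _).
move=> wv pos; have c2 : 0 < c ^+ 2 by rewrite exprn_even_gt0.
by rewrite -(ler_pM2l c2); nra.
Qed.

Lemma opbound_conj c m n (A : 'M[R[i]]_(m, n)) :
  opbound c A -> opbound c (map_mx Num.conj A).
Proof.
move=> hA x; have := hA (map_mx Num.conj x).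
by rewrite -(fro2_conj (_ *m _)) map_mxM conjMK fro2_conj.
Qed.

Lemma opbound_sadj h c m n (A : 'M[R[i]]_(m, n)) :
  opbound c A -> opbound c (sadj h A).
Proof.
case: h; first exact: opbound_sadjC.
by move=> /opbound_sadjC/opbound_conj; rewrite conj_sadj sadj_sadjC sadjK.
Qed.

(** The cross term is controlled by [0 <= |A x - B x|^2]. This is what allows averaging over the
    symmetries of a class. *)
Lemma opbound_half c m n (A B : 'M[R[i]]_(m, n)) :
  opbound c A -> opbound c B -> opbound c ((2^-1)%:C *: (A + B)).
Proof.
move=> hA hB x; rewrite -scalemxAl mulmxDl fro2Z fro2D.
have := fro2_ge0 (A *m x - B *m x); rewrite fro2B.
have := hA x; have := hB x.
move: (fro2 (A *m x)) (fro2 (B *m x)) (c ^+ 2 * _) (redot _ _) => a b d e *.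
have -> : (2^-1 : R) ^+ 2 = 4^-1 by field.
lra.
Qed.

Lemma opbound0 c m n : opbound c (0 : 'M[R[i]]_(m, n)).
Proof. by move=> x; rewrite mul0mx fro2_0 mulr_ge0 ?sqr_ge0 ?fro2_ge0. Qed.

Lemma normc_sum n (F : 'I_n -> R[i]) :
  ComplexField.Normc.normc (\sum_i F i) <= \sum_i ComplexField.Normc.normc (F i).
Proof.
apply: (big_ind2 (fun x y => ComplexField.Normc.normc x <= y)) => //.
  by rewrite ComplexField.Normc.normc0.
move=> x1 x2 y1 y2 h1 h2; apply: le_trans (le_normcD _ _) _; exact: lerD.
Qed.

Lemma normc_ge0 (x : R[i]) : 0 <= ComplexField.Normc.normc x.
Proof. by case: x => a b; apply: sqrtr_ge0. Qed.

(** Any finite bound serves: it makes the set in [spec_norm] bounded, so that its supremum is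
    meaningful. *)
Lemma opbound_exists m n (A : 'M[R[i]]_(m, n)) :
  exists2 c, 0 <= c & opbound c A.
Proof.
pose N (x : R[i]) := ComplexField.Normc.normc x.
(* The constant comes from the triangle inequality in each row, with [|x_j| <= |x|]. *)
pose s := \sum_i (\sum_j N (A i j)) ^+ 2.
have s0 : 0 <= s by apply: sumr_ge0 => i _; apply: sqr_ge0.
exists (Num.sqrt s); first exact: sqrtr_ge0.
move=> x; rewrite sqr_sqrtr // fro2E /s mulr_suml.
apply: ler_sum => i _; rewrite big_ord1 mxE -fro_norm2 -exprMn.
rewrite ler_pXn2r ?nnegrE ?normc_ge0 //; last first.
  by rewrite mulr_ge0 ?fro_norm_ge0 ?sumr_ge0 // => j _; apply: normc_ge0.
apply: le_trans (normc_sum _) _; rewrite mulr_suml; apply: ler_sum => j _.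
rewrite ComplexField.Normc.normcM ler_wpM2l ?normc_ge0 //.
rewrite -(@ler_pXn2r _ 2) ?nnegrE ?normc_ge0 ?fro_norm_ge0 //.
rewrite fro_norm2 fro2E (bigD1 j) //= big_ord1 lerDl.
by do 2! apply: sumr_ge0 => ? _; apply: sqr_ge0.
Qed.

Lemma spec_norm_has_sup m n (A : 'M[R[i]]_(m, n)) :
  has_sup [set fro_norm (A *m x) | x in [set x : 'cV[R[i]]_n | fro_norm x <= 1]]%classic.
Proof.
split; first by exists (fro_norm (A *m (0 : 'cV[R[i]]_n))), 0 => //=; rewrite fro_normE fro2_0 sqrtr0.
have [c c0 hc] := opbound_exists A; exists c => _ [x /= x1 <-].
rewrite -(@ler_pXn2r _ 2) ?nnegrE ?fro_norm_ge0 // fro_norm2.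
apply: le_trans (hc x) _; rewrite -fro_norm2 ler_piMr ?sqr_ge0 //.
by rewrite exprn_ile1 ?fro_norm_ge0.
Qed.

Lemma spec_normP c m n (A : 'M[R[i]]_(m, n)) :
  0 <= c -> (spec_norm A <= c <-> opbound c A).
Proof.
move=> c0; split=> hA.
  move=> x; have [/eqP x0|x0] := boolP (fro2 x == 0).
    by rewrite (fro2_eq0 x0) mulmx0 !fro2_0 mulr0.
  have x0' : 0 < fro2 x by rewrite lt_def x0 fro2_ge0.
  pose y := ((fro_norm x)^-1)%:C *: x.
  have fy : fro2 y = 1 by rewrite fro2Z exprVn fro_norm2 mulVf.
  have : fro_norm (A *m y) <= c.
    apply: le_trans hA; apply: sup_upper_bound; first exact: spec_norm_has_sup.
    by exists y => //=; rewrite fro_normE fy sqrtr1.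
  rewrite -(@ler_pXn2r _ 2) ?nnegrE ?fro_norm_ge0 // fro_norm2.
  by rewrite -scalemxAr fro2Z exprVn fro_norm2 mulrC ler_pdivrMr.
apply: ge_sup; first by case: (spec_norm_has_sup A).
move=> _ [x /= x1 <-].
rewrite -(@ler_pXn2r _ 2) ?nnegrE ?fro_norm_ge0 // fro_norm2.
apply: le_trans (hA x) _; rewrite -fro_norm2 ler_piMr ?sqr_ge0 //.
by rewrite exprn_ile1 ?fro_norm_ge0.
Qed.

Lemma spec_norm_ge0 m n (A : 'M[R[i]]_(m, n)) : 0 <= spec_norm A.
Proof.
apply: le_trans (fro_norm_ge0 (A *m (0 : 'cV_n))) _; apply: sup_upper_bound.
  exact: spec_norm_has_sup.
by exists 0 => //=; rewrite fro_normE fro2_0 sqrtr0.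
Qed.

End OpBound.

(** * Moore-Penrose pseudo-inverses and factorization *)

Section PseudoInverse.
Variable R : realType.
Implicit Types (m n p : nat) (h : bool).

Lemma mulmx_inj_cV m n (A B : 'M[R[i]]_(m, n)) :
  (forall x : 'cV[R[i]]_n, A *m x = B *m x) -> A = B.
Proof.
move=> AB; apply/matrixP => i j; have /matrixP/(_ i 0) := AB (delta_mx j 0).
by rewrite -!colE !mxE.
Qed.

Lemma fro2_mulmx0 m n p (A : 'M[R[i]]_(m, n)) (B : 'M[R[i]]_(n, p)) :
  A^H *m (A *m B) = 0 -> A *m B = 0.
Proof. by move=> AB; apply: fro2_eq0; rewrite /fro2 redot_mull AB redot0r. Qed.

(** If [A^H A v = 0] then [|A v|^2 = <v, A^H A v> = 0], and a left inverse of [A] gives [v = 0]. *)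
Lemma gram_unit m n (A : 'M[R[i]]_(m, n)) :
  row_full A -> A^H *m A \in unitmx.
Proof.
move=> /row_fullP [B BA]; rewrite -row_free_unit -kermx_eq0.
have k0 : kermx (A^H *m A) *m A^H *m A = 0 by rewrite -mulmxA mulmx_ker.
have : A *m (kermx (A^H *m A))^H = 0.
  apply: fro2_mulmx0.
  by have := congr1 (@sadj _ true _ _) k0; rewrite !sadjM sadjK sadj0.
move/(congr1 (mulmx B)); rewrite mulmxA BA mul1mx mulmx0.
by move/(congr1 (@sadj _ true _ _)); rewrite sadjK sadj0 => ->.
Qed.

Lemma row_full_left_inverse m n (A : 'M[R[i]]_(m, n)) :
  row_full A -> exists2 Y, Y *m A = 1%:M & (A *m Y)^H = A *m Y.
Proof.
move=> /gram_unit uG; exists (invmx (A^H *m A) *m A^H).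
  by rewrite -mulmxA mulVmx.
have ih : (invmx (A^H *m A))^H = invmx (A^H *m A).
  have : (A^H *m A)^H = A^H *m A by rewrite sadjM sadjK.
  move: (A^H *m A) => G Gh; rewrite sadjE trmx_inv map_invmx.
  exact: (congr1 invmx Gh).
by rewrite !sadjM sadjK ih mulmxA.
Qed.

(** For a full-rank factorization, the pseudo-inverse is the product, in reverse order, of one-sided
    inverses chosen so that the resulting projections are Hermitian. *)
Lemma is_mpinv_factor m n k (L : 'M[R[i]]_(m, k)) (Q : 'M[R[i]]_(k, n)) :
  row_full L -> row_full Q^H -> exists Y, is_mpinv (L *m Q) Y.
Proof.
move=> /row_full_left_inverse[L' L'L LL'] /row_full_left_inverse[Q' Q'Q QQ'].
have {}Q'Q : Q *m Q'^H = 1%:M by rewrite -[LHS](sadjK true) sadjM sadjK Q'Q sadj1.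
have {}QQ' : (Q'^H *m Q)^H = Q'^H *m Q.
  by rewrite -[in RHS](sadjK true Q) -sadjM QQ' sadjM sadjK.
exists (Q'^H *m L'); rewrite /is_mpinv -!sadjCE.
have -> : L *m Q *m (Q'^H *m L') = L *m L'.
  by rewrite mulmxA -(mulmxA L) Q'Q mulmx1.
have -> : Q'^H *m L' *m (L *m Q) = Q'^H *m Q.
  by rewrite mulmxA -(mulmxA Q'^H) L'L mulmx1.
split=> //; first by rewrite mulmxA -(mulmxA L) L'L mulmx1.
by rewrite mulmxA -(mulmxA Q'^H) Q'Q mulmx1.
Qed.

Lemma is_mpinv_exists m n (A : 'M[R[i]]_(m, n)) : exists Y, is_mpinv A Y.
Proof.
have fQ : row_full (row_base A)^H.
  have /row_freeP [Q' QQ'] := row_base_free A.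
  by apply/row_fullP; exists (Q'^H); rewrite -sadjM QQ' sadj1.
by have := is_mpinv_factor (col_base_full A) fQ; rewrite mulmx_base.
Qed.

Lemma is_mpinv_uniq m n (A : 'M[R[i]]_(m, n)) Y Z :
  is_mpinv A Y -> is_mpinv A Z -> Y = Z.
Proof.
rewrite /is_mpinv -!sadjCE => -[y1 y2 y3 y4] [z1 z2 z3 z4].
have AY : A *m Y = A *m Z.
  by rewrite -y3 -{1}z1 -mulmxA sadjM y3 z3 mulmxA y1.
have YA : Y *m A = Z *m A.
  by rewrite -y4 -{1}z1 -mulmxA mulmxA sadjM y4 z4 -mulmxA (mulmxA A) y1.
by rewrite -y2 -mulmxA AY mulmxA YA.
Qed.

Lemma mpinvP m n (A : 'M[R[i]]_(m, n)) : is_mpinv A (mpinv A).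
Proof. by apply: xgetPex; apply: is_mpinv_exists. Qed.

Lemma mpinv_eq m n (A : 'M[R[i]]_(m, n)) Y : is_mpinv A Y -> mpinv A = Y.
Proof. exact/is_mpinv_uniq/mpinvP. Qed.

Lemma mpinv_conj m n (A : 'M[R[i]]_(m, n)) :
  mpinv (map_mx Num.conj A) = map_mx Num.conj (mpinv A).
Proof.
apply: mpinv_eq; have [y1 y2 y3 y4] := mpinvP A.
by split; rewrite -!map_mxM ?y1 ?y2 // map_trmx ?y3 ?y4.
Qed.

(** Write [Y = Y (A Y)] with [A Y] Hermitian. The rows of the pseudo-inverse thus lie in the row
    space of [A^H], which is the range condition needed in the completion problem. *)
Lemma mpinv_mulr m n (A : 'M[R[i]]_(m, n)) :
  mpinv A = mpinv A *m (mpinv A)^H *m A^H.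
Proof.
have [y1 y2 y3 y4] := mpinvP A.
by rewrite -{1}y2 -mulmxA -y3 -sadjCE sadjM !mulmxA.
Qed.

Lemma herm_idem_contraction n (P : 'M[R[i]]_n) :
  P^H = P -> P *m P = P -> opbound 1 P.
Proof.
move=> Ph PP x; rewrite expr1n mul1r -[x in leRHS](subrK (P *m x)).
rewrite fro2D redotC redot_mull Ph mulmxBr mulmxA PP subrr redot0r mulr0 addr0.
by rewrite lerDr fro2_ge0.
Qed.

(* Douglas' factorization lemma *)
Lemma contraction_factor m n p (A : 'M[R[i]]_(m, p)) (B : 'M[R[i]]_(n, p)) :
  (forall x : 'cV[R[i]]_p, fro2 (A *m x) <= fro2 (B *m x)) ->
  A = A *m mpinv B *m B /\ opbound 1 (A *m mpinv B).
Proof.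
move=> AB; have [y1 y2 y3 y4] := mpinvP B; split.
  apply: mulmx_inj_cV => x; apply/eqP; rewrite -subr_eq0; apply/eqP/fro2_eq0.
  (* [B] kills [x - B^+ B x], and by domination so does [A]. *)
  have -> : A *m x - A *m mpinv B *m B *m x = A *m (x - mpinv B *m B *m x).
    by rewrite mulmxBr !mulmxA.
  apply/eqP; rewrite eq_le fro2_ge0 andbT; apply: le_trans (AB _) _.
  by rewrite mulmxBr !mulmxA y1 subrr fro2_0.
move=> x; rewrite -mulmxA; apply: le_trans (AB _) _.
rewrite mulmxA; apply: herm_idem_contraction => //.
by rewrite mulmxA y1.
Qed.

End PseudoInverse.

(** * Positive semidefinite matrices and their square roots *)

Section PsdSqrt.
Variable R : realType.
Implicit Types (m n p : nat) (h : bool).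

Lemma hermsymmxE n (A : 'M[R[i]]_n) : (A \is hermsymmx) = (A^H == A).
Proof. by rewrite qualifE /= expr0 scale1r eq_sym. Qed.

Lemma mx11_trace (x : 'M[R[i]]_1) : x 0 0 = \tr x.
Proof. by rewrite /mxtrace big_ord1. Qed.

(** The quadratic form of a Hermitian matrix is real, so the inequality in [R[i]] reduces to one on
    real parts. *)
Lemma psdP n (A : 'M[R[i]]_n) :
  psd A <-> A^H = A /\ forall x : 'cV[R[i]]_n, 0 <= redot x (A *m x).
Proof.
rewrite /psd hermsymmxE; split=> -[]; [move=> /eqP Ah pos | move=> Ah pos].
  split=> // x; have := pos x.
  by rewrite mx11_trace -mulmxA lecE => /andP[].
split; first exact/eqP.
move=> x; have := pos x; rewrite redotE mx11_trace -mulmxA.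
set t := \tr _ => t0; have tJ : Num.conj t = t.
  by rewrite -mxtrace_conj /t -mxtrace_tr map_trmx -sadjCE !sadjM sadjK Ah mulmxA.
have : t \is Num.real by apply/CrealP.
by case/complex_realP => s ts; move: t0; rewrite ts ler0c.
Qed.

Lemma psd_gram m n (A : 'M[R[i]]_(m, n)) : psd (A^H *m A).
Proof.
apply/psdP; split; first by rewrite sadjM sadjK.
by move=> x; rewrite -mulmxA -[A in A *m x](sadjK true) redotC redot_mull sadjK fro2_ge0.
Qed.

Lemma psd_sadj h n (A : 'M[R[i]]_n) : psd A -> psd (sadj h A).
Proof.
move=> /psdP[Ah pos]; apply/psdP; split; first by rewrite -sadj_sadjC Ah.
case: h => x; first by rewrite Ah.
have := pos (map_mx Num.conj x).
by rewrite -redot_conj map_mxM conjMK conj_sadj -sadj_sadjC Ah.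
Qed.

Lemma psd_conj n (A : 'M[R[i]]_n) : psd A -> psd (map_mx Num.conj A).
Proof. by rewrite conj_sadj => /(psd_sadj false)/(psd_sadj true). Qed.

Definition rdiag n (f : 'I_n -> R) : 'M[R[i]]_n := diag_mx (\row_j (f j)%:C).

Lemma rdiag_mul n (f g : 'I_n -> R) :
  rdiag f *m rdiag g = rdiag (fun j => f j * g j).
Proof.
by rewrite /rdiag mulmx_diag; congr diag_mx; apply/rowP => j; rewrite !mxE rmorphM.
Qed.

Lemma rdiag_sadj h n (f : 'I_n -> R) : sadj h (rdiag f) = rdiag f.
Proof.
apply/matrixP => i j; case: h; rewrite sadjE !mxE [in LHS]eq_sym.
  by rewrite rmorphMn /= conjCr; case: eqP => [->|_]; rewrite ?mulr0n.
by case: eqP => [->|_]; rewrite ?mulr0n.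
Qed.

Lemma herm_spectral n (M : 'M[R[i]]_n) : M^H = M ->
  exists (P : 'M[R[i]]_n) (d : 'rV[R[i]]_n),
    P *m P^H = 1%:M /\ M = P^H *m diag_mx d *m P.
Proof.
move=> /eqP; rewrite -hermsymmxE => Mh; exists (spectralmx M), (spectral_diag M).
split; first exact/unitarymxP/spectral_unitarymx.
have /orthomx_spectralP := hermitian_normalmx Mh.
by rewrite invmx_unitary ?spectral_unitarymx.
Qed.

Lemma psd_sqrt_exists n (M : 'M[R[i]]_n) : psd M -> exists Q, psd Q /\ Q *m Q = M.
Proof.
move=> pM; have [Mh pos] := (psdP M).1 pM.
have [P [d [PP defM]]] := herm_spectral Mh.
(* The eigenvalue [d 0 j] is the value of the quadratic form of [M] at the eigenvector [P^H e_j]. *)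
have d0 j : 0 <= d 0 j.
  have := pM.2 (P^H *m delta_mx j (0 : 'I_1)); rewrite -sadjCE.
  have -> : (P^H *m delta_mx j (0 : 'I_1))^H *m M *m (P^H *m delta_mx j (0 : 'I_1))
     = delta_mx 0 j *m (diag_mx d *m delta_mx j 0).
    rewrite sadjM sadjK {1}defM !mulmxA -(mulmxA _ P P^H) PP mulmx1.
    rewrite -(mulmxA _ P P^H) PP mulmx1; congr (_ *m _ *m _).
    by apply/matrixP => a b; rewrite !mxE conjC_nat andbC.
  by rewrite -colE -rowE !mxE eqxx.
pose f j := complex.Re (d 0 j).
have df : diag_mx d = rdiag f.
  congr diag_mx; apply/rowP => j; rewrite mxE /f RRe_real //.
  exact: ger0_real.
have f0 j : 0 <= f j by rewrite -ler0c /f RRe_real ?d0 // ger0_real.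
(* Fourth roots of the eigenvalues: the square root of [M] is then the Gram matrix [G^H *m G], hence
   positive by [psd_gram]. *)
pose G := rdiag (fun j => Num.sqrt (Num.sqrt (f j))) *m P.
exists (G^H *m G); split; first exact: psd_gram.
have -> : G^H *m G = P^H *m rdiag (fun j => Num.sqrt (f j)) *m P.
  rewrite sadjM rdiag_sadj mulmxA -(mulmxA P^H) rdiag_mul.
  congr (_ *m rdiag _ *m _); apply/funext => j.
  by rewrite -expr2 sqr_sqrtr ?sqrtr_ge0.
rewrite [RHS]defM df !mulmxA -(mulmxA _ P P^H) PP mulmx1 -(mulmxA P^H) rdiag_mul.
by congr (_ *m rdiag _ *m _); apply/funext => j; rewrite -expr2 sqr_sqrtr.
Qed.

Lemma redot_cols m n (A B : 'M[R[i]]_(m, n)) :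
  redot A B = \sum_j redot (col j A) (col j B).
Proof.
rewrite redotE /mxtrace (big_morph _ (@ReD R) erefl); apply: eq_bigr => j _.
rewrite redotE -mx11_trace !mxE; congr complex.Re.
by apply: eq_bigr => i _; rewrite !mxE.
Qed.

Lemma psd_redot_ge0 n p (A : 'M[R[i]]_n) (Y : 'M[R[i]]_(n, p)) :
  psd A -> 0 <= redot Y (A *m Y).
Proof.
move=> /psdP[_ pos]; rewrite redot_cols; apply: sumr_ge0 => j _.
by have := pos (col j Y); rewrite !colE mulmxA.
Qed.

(** With [A = G *m G] and [G] Hermitian, [<Y, A Y> = |G Y|^2]. *)
Lemma psd_redot_eq0 n p (A : 'M[R[i]]_n) (Y : 'M[R[i]]_(n, p)) :
  psd A -> redot Y (A *m Y) = 0 -> A *m Y = 0.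
Proof.
move=> /psd_sqrt_exists[G [/psdP[Gh _] <-]].
rewrite -mulmxA -{1}Gh -redot_mull => /fro2_eq0 ->.
by rewrite mulmx0.
Qed.

(* Y := E Q - Q' E satisfies Q' Y + Y Q = 0, so that the two nonnegative
   quantities <Y, Q' Y> and <Y, Y Q> add up to zero. *)
Lemma psd_intertwine m n (E : 'M[R[i]]_(m, n)) (Q : 'M[R[i]]_n) (Q' : 'M[R[i]]_m) :
  psd Q -> psd Q' -> E *m (Q *m Q) = Q' *m Q' *m E -> E *m Q = Q' *m E.
Proof.
move=> pQ pQ' EQ; have [Qh _] := (psdP Q).1 pQ; have [Q'h _] := (psdP Q').1 pQ'.
pose Y := E *m Q - Q' *m E; have : Q' *m Y + Y *m Q = 0.
  by rewrite /Y mulmxBl mulmxBr !mulmxA -EQ !mulmxA subrKA subrr.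
move=> QY; have YQE : redot Y (Y *m Q) = redot Y^H (Q *m Y^H).
  by rewrite -(redot_sadj true) sadjM Qh.
have := congr1 (redot Y) QY; rewrite redotDr redot0r YQE.
have a0 := psd_redot_ge0 Y pQ'; have b0 := psd_redot_ge0 Y^H pQ.
move=> /eqP; rewrite paddr_eq0 // => /andP[/eqP a1 /eqP b1].
have {}a1 := psd_redot_eq0 pQ' a1; have {}b1 := psd_redot_eq0 pQ b1.
have {}b1 : Y *m Q = 0 by rewrite -(sadjK true (_ *m _)) sadjM Qh b1 sadj0.
apply/eqP; rewrite -subr_eq0 -/Y; apply/eqP/fro2_eq0.
rewrite /fro2 {2}/Y redotDr redotNr -{1}Qh -redot_mulr b1 redot0l.
by rewrite -{1}Q'h -redot_mull a1 redot0l subrr.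
Qed.

Lemma psd_sqrtP n (M : 'M[R[i]]_n) :
  psd M -> psd (psd_sqrt M) /\ psd_sqrt M *m psd_sqrt M = M.
Proof.
move=> pM; apply: (xgetPex 0 (P := [set Q | psd Q /\ Q *m Q = M]%classic)).
exact: psd_sqrt_exists.
Qed.

(** Uniqueness of the positive square root is [psd_intertwine] with the identity as intertwiner. *)
Lemma psd_sqrt_eq n (M Q : 'M[R[i]]_n) : psd Q -> Q *m Q = M -> psd_sqrt M = Q.
Proof.
move=> pQ QM; have pM : psd M.
  by have := psd_gram Q; rewrite ((psdP Q).1 pQ).1 QM.
have [pS SM] := psd_sqrtP pM.
rewrite -[LHS]mulmx1 -[RHS]mul1mx; symmetry; apply: psd_intertwine => //.
by rewrite mul1mx mulmx1 QM SM.
Qed.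

Lemma psd_sqrt_sadj h n (M : 'M[R[i]]_n) :
  psd M -> psd_sqrt (sadj h M) = sadj h (psd_sqrt M).
Proof.
move=> /psd_sqrtP[pS SM]; apply: psd_sqrt_eq; first exact: psd_sadj.
by rewrite -sadjM SM.
Qed.

Lemma psd_sqrt_conj n (M : 'M[R[i]]_n) :
  psd M -> psd_sqrt (map_mx Num.conj M) = map_mx Num.conj (psd_sqrt M).
Proof.
move=> /psd_sqrtP[pS SM]; apply: psd_sqrt_eq; first exact: psd_conj.
by rewrite -map_mxM SM.
Qed.

End PsdSqrt.

(** * Completion of block matrices under a norm bound *)

Section Completion.
Variable R : realType.
Implicit Types (mu : R).

(** [Q] is the defect operator of [E] at level [mu]: it measures what [E] leaves of the bound. *)
Lemma fro2_defect a b (mu : R) (E : 'M[R[i]]_(a, b)) (Q : 'M[R[i]]_b)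
    (x : 'cV[R[i]]_b) :
  Q^H = Q -> Q *m Q = (mu ^+ 2)%:C%:M - E^H *m E ->
  fro2 (Q *m x) = mu ^+ 2 * fro2 x - fro2 (E *m x).
Proof.
move=> Qh QQ; rewrite /fro2 redot_mull Qh mulmxA QQ mulmxBl mul_scalar_mx.
by rewrite redotDr redotZr redotNr -mulmxA -redot_mull.
Qed.

(* Up to the factor mu, the block matrix [E Q'; Q -E^H] is unitary. *)
Lemma fro2_julia a b (mu : R) (E : 'M[R[i]]_(a, b)) (Q : 'M[R[i]]_b)
    (Q' : 'M[R[i]]_a) (x : 'cV[R[i]]_b) (y : 'cV[R[i]]_a) :
  Q^H = Q -> Q'^H = Q' -> Q *m Q = (mu ^+ 2)%:C%:M - E^H *m E ->
  Q' *m Q' = (mu ^+ 2)%:C%:M - E *m E^H -> E *m Q = Q' *m E ->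
  fro2 (E *m x + Q' *m y) + fro2 (Q *m x - E^H *m y)
    = mu ^+ 2 * (fro2 x + fro2 y).
Proof.
move=> Qh Q'h QQ QQ' EQ; rewrite fro2D fro2B.
rewrite (fro2_defect x Qh QQ).
have -> : fro2 (Q' *m y) = mu ^+ 2 * fro2 y - fro2 (E^H *m y).
  by apply: fro2_defect; rewrite // sadjK.
have -> : redot (Q *m x) (E^H *m y) = redot (E *m x) (Q' *m y).
  rewrite !redot_mull !mulmxA Qh; congr (redot _ (_ *m _)).
  by have := congr1 (@sadj _ true _ _) EQ; rewrite !sadjM Qh Q'h.
move: (fro2 x) (fro2 y) (fro2 _) (fro2 _) (redot _ _) (mu ^+ 2) => *; ring.
Qed.

Lemma mul_block_col_fro2 a b c d (E : 'M[R[i]]_(a, b)) (F : 'M[R[i]]_(a, d))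
    (C : 'M[R[i]]_(c, b)) (D : 'M[R[i]]_(c, d)) x y :
  fro2 (block_mx E F C D *m col_mx x y : 'cV_(a + c))
    = fro2 (E *m x + F *m y) + fro2 (C *m x + D *m y).
Proof. by rewrite mul_block_col fro2_col_mx. Qed.

(** The adjoint of [[k P]] is an isometry, so [[k P]] is a contraction. *)
Lemma row_coisometry a b c (k : 'M[R[i]]_(c, a)) (P : 'M[R[i]]_(c, b))
    (x : 'cV[R[i]]_a) (y : 'cV[R[i]]_b) :
  k *m k^H + P *m P^H = 1%:M -> fro2 (k *m x + P *m y) <= fro2 x + fro2 y.
Proof.
move=> kP; rewrite -mul_row_col -fro2_col_mx.
have h : opbound 1 (row_mx k P)^H.
  move=> z; rewrite sadj_row_mx /fro2 redot_mull sadj_col_mx !sadjK mulmxA.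
  by rewrite mul_row_col kP mul1mx expr1n mul1r.
by have := opbound_sadj true h (col_mx x y); rewrite sadjK expr1n mul1r.
Qed.

(* Parrott's completion problem in the form of Davis, Kahan and Weinberger:
   the contractive completions D are parametrized by a contraction Z. *)
Section Parrott.
Variables (a b c d : nat) (mu : R) (E : 'M[R[i]]_(a, b)).
Variables (Q : 'M[R[i]]_b) (Q' : 'M[R[i]]_a).
Variables (k0 : 'M[R[i]]_(c, b)) (L0 : 'M[R[i]]_(a, d)).
Variables (k : 'M[R[i]]_(c, b)) (L : 'M[R[i]]_(a, d)).
Variables (P : 'M[R[i]]_c) (P2 : 'M[R[i]]_d).
Hypotheses (pQ : psd Q) (pQ' : psd Q').
Hypothesis QQ : Q *m Q = (mu ^+ 2)%:C%:M - E^H *m E.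
Hypothesis QQ' : Q' *m Q' = (mu ^+ 2)%:C%:M - E *m E^H.
(** For singular [Q] or [Q'], the blocks [k Q] and [Q' L] do not determine [k] and [L]. These
    equations select the solutions with the rows of [k] in the row space of [Q] and the columns of
    [L] in the column space of [Q']. *)
Hypotheses (kE : k = k0 *m Q) (LE : L = Q' *m L0).
Hypotheses (Ph : P^H = P) (P2h : P2^H = P2).
Hypothesis PP : P *m P = 1%:M - k *m k^H.
Hypothesis PP2 : P2 *m P2 = 1%:M - L^H *m L.

Let Qh : Q^H = Q := ((psdP Q).1 pQ).1.
Let Q'h : Q'^H = Q' := ((psdP Q').1 pQ').1.

Let EQ : E *m Q = Q' *m E.
Proof.
apply: psd_intertwine => //.
by rewrite QQ QQ' mulmxBl mulmxBr mul_scalar_mx mul_mx_scalar mulmxA.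
Qed.

Let EQ' : E^H *m Q' = Q *m E^H.
Proof. by have := congr1 (@sadj _ true _ _) EQ; rewrite !sadjM Qh Q'h. Qed.

Let P2E (y : 'cV[R[i]]_d) : fro2 (P2 *m y) = fro2 y - fro2 (L *m y).
Proof.
rewrite (@fro2_defect _ _ 1 L) ?expr1n ?mul1r //.
Qed.

Let PE (y : 'cV[R[i]]_c) : fro2 (P *m y) = fro2 y - fro2 (k^H *m y).
Proof.
by rewrite (@fro2_defect _ _ 1 k^H) ?expr1n ?mul1r // sadjK.
Qed.

(** The lower block row sends [(x, y)] to [k u + P v] with [u = Q x - E^H L y] and [v = mu Z P2 y],
    of squared norm at most [|u|^2 + |v|^2]. By [fro2_julia], [|u|^2] and the upper row add up to
    [mu^2 (|x|^2 + |L y|^2)], while [|v|^2 <= mu^2 (|y|^2 - |L y|^2)]. *)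
Lemma parrott_suff (Z : 'M[R[i]]_(c, d)) : opbound 1 Z ->
  opbound mu (block_mx E (Q' *m L) (k *m Q)
                (mu%:C *: (P *m Z *m P2) - k *m E^H *m L)).
Proof.
move=> hZ xy; rewrite -(vsubmxK xy); move: (usubmx xy) (dsubmx xy) => x y.
rewrite mul_block_col_fro2 fro2_col_mx.
have -> : k *m Q *m x + (mu%:C *: (P *m Z *m P2) - k *m E^H *m L) *m y
   = k *m (Q *m x - E^H *m (L *m y)) + P *m (mu%:C *: (Z *m (P2 *m y))).
  rewrite mulmxBr mulmxBl -scalemxAl -scalemxAr !mulmxA -!addrA; congr (_ + _).
  by rewrite addrC.
have kP : k *m k^H + P *m P^H = 1%:M by rewrite Ph PP addrC subrK.
have := row_coisometry (Q *m x - E^H *m (L *m y)) (mu%:C *: (Z *m (P2 *m y))) kP.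
rewrite fro2Z -(mulmxA Q').
have := fro2_julia x (L *m y) Qh Q'h QQ QQ' EQ.
have := hZ (P2 *m y); rewrite expr1n mul1r P2E.
move: (fro2 (k *m _ + _)) (fro2 (E *m x + _)) (fro2 (Q *m x - _)).
move: (fro2 (Z *m _)) (fro2 (L *m y)) (fro2 x) (fro2 y) => z l u v s t w h1 h2 h3.
have m0 := sqr_ge0 mu; have := ler_wpM2l m0 h1.
move: (mu ^+ 2) h2 h3 => m h2 h3 h4; nra.
Qed.

Lemma parrott_nec (D : 'M[R[i]]_(c, d)) :
  opbound mu (block_mx E (Q' *m L) (k *m Q) D) ->
  exists2 Z : 'M[R[i]]_(c, d), opbound 1 Z &
    D = mu%:C *: (P *m Z *m P2) - k *m E^H *m L.
Proof.
move=> /(opbound_sadj true) hT.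
pose T2 := row_mx (L^H *m Q') D^H.
(* [S] is built so that [|S x|^2] equals [mu^2 |x|^2] minus the squared norm of the first block row
   of the adjoint at [x]. As [T2] is the second block row, the bound on the adjoint reads
   [|T2 x| <= |S x|]. *)
pose S := block_mx Q' (- (E *m k^H)) 0 (mu%:C *: P).
have hS (x : 'cV[R[i]]_(a + c)) : fro2 (T2 *m x) <= fro2 (S *m x).
  have := hT x; rewrite -(vsubmxK x).
  move: (usubmx x) (dsubmx x) => y1 y2.
  rewrite sadj_block_mx !mul_block_col_fro2 fro2_col_mx mul_row_col !sadjM Qh Q'h mul0mx add0r.
  rewrite mulNmx -(mulmxA Q) -(mulmxA E).
  have EQ'' : E^H *m Q' = Q *m E^H := EQ'.
  have := @fro2_julia _ _ mu E^H Q' Q y1 (k^H *m y2) Q'h Qh.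
  rewrite sadjK => /(_ QQ' QQ EQ'') h1.
  rewrite -scalemxAl fro2Z PE.
  move: h1.
  move: (fro2 (E^H *m _ + _)) (fro2 (Q' *m _ - _)) (fro2 (L^H *m _ *m _ + _)).
  by move: (fro2 y1) (fro2 y2) (fro2 (k^H *m _)) => u v s t w z h1 h2; nra.
have [TS hW] := contraction_factor hS.
pose W := (T2 *m mpinv S)^H; have {}hW : opbound 1 W by apply: opbound_sadj.
have {}TS : T2^H = S^H *m W by rewrite -sadjM -TS.
have {TS} [e1 e2] : Q' *m L = Q' *m usubmx W /\
    D = mu%:C *: (P *m dsubmx W) - k *m E^H *m usubmx W.
  move: TS; rewrite -(vsubmxK W) /T2 /S sadj_row_mx sadj_block_mx sadj0 sadjN sadjZ !sadjM !sadjK Q'h Ph.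
  rewrite mul_block_col mul0mx addr0 => /eq_col_mx[-> ->].
  by rewrite col_mxKu col_mxKd mulNmx -scalemxAl addrC.
(* Here [k E^H = k0 Q E^H = k0 E^H Q'], and [Q'] takes the same value on the upper half of [W] and
   on [L]. *)
have ew : k *m E^H *m usubmx W = k *m E^H *m L.
  by rewrite kE -!(mulmxA k0) -EQ' !mulmxA -!(mulmxA _ Q') e1.
(* Let [u] be the upper half of [W]. From [Q' (u - L) = 0] and [L = Q' L0], the ranges of [L] and
   [u - L] are orthogonal, so [|L x| <= |u x|]. Contractivity of [W] then leaves at most [|P2 x|^2]
   for the lower half, which allows the second factorization. *)
have hw (x : 'cV[R[i]]_d) : fro2 (dsubmx W *m x) <= fro2 (P2 *m x).
  have := hW x; rewrite -{1}(vsubmxK W) mul_col_mx fro2_col_mx P2E expr1n mul1r.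
  have -> : usubmx W *m x = L *m x + (usubmx W - L) *m x.
    by rewrite mulmxBl addrC subrK.
  have Lw : L^H *m (usubmx W - L) = 0.
    by rewrite LE sadjM Q'h -mulmxA mulmxBr -LE -e1 subrr mulmx0.
  rewrite fro2D redot_mull mulmxA Lw mul0mx redot0r.
  have := fro2_ge0 ((usubmx W - L) *m x).
  by move: (fro2 _) (fro2 _) (fro2 _) (fro2 _) => *; lra.
have [e3 hZ] := contraction_factor hw.
by exists (dsubmx W *m mpinv P2) => //; rewrite e2 ew {1}e3 !mulmxA.
Qed.

End Parrott.
End Completion.

(** * Structured classes and averaging over their symmetries *)

Section Core.
Variable R : realType.

Lemma inf_min (A : set R) (m : R) :
  A m -> (forall x, A x -> m <= x) -> inf A = m.
Proof.
move=> Am mA; apply/eqP; rewrite eq_le; apply/andP; split.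
  by apply: ge_inf => //; exists m.
by apply: lb_le_inf => //; exists m.
Qed.

(* The sign e is -1 for skew-sym and 1 otherwise; rl asks for real entries. *)
Definition struct_class (h rl : bool) (e : R) k (A : 'M[R[i]]_k) : Prop :=
  (rl -> map_mx Num.conj A = A) /\ sadj h A = e%:C *: A.

Section StructClass.
Variables (h rl : bool) (e : R).
Local Notation class := (struct_class h rl e).

Lemma struct_class0 k : class (0 : 'M[R[i]]_k).
Proof. by split=> [_|]; rewrite ?map_mx0 // sadj0 scaler0. Qed.

Lemma struct_classD k (A B : 'M[R[i]]_k) : class A -> class B -> class (A + B).
Proof.
move=> [Ar As] [Br Bs]; split=> [r1|]; first by rewrite map_mxD Ar ?Br.
by rewrite sadjD As Bs scalerDr.
Qed.

Lemma struct_classZ (a : R) k (A : 'M[R[i]]_k) : class A -> class (a%:C *: A).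
Proof.
move=> [Ar As]; split=> [r1|]; first by rewrite map_mxZ /= conjCr Ar.
by rewrite sadjZ As !scalerA mulrC.
Qed.

Lemma struct_classN k (A : 'M[R[i]]_k) : class A -> class (- A).
Proof. by move=> /(struct_classZ (- 1)); rewrite rmorphN1 scaleN1r. Qed.

Lemma struct_class_congr j k (P : 'M[R[i]]_(j, k)) (A : 'M[R[i]]_k) :
  (rl -> map_mx Num.conj P = P) -> class A -> class (P *m A *m sadj h P).
Proof.
move=> Pr [Ar As]; split=> [r1|].
  by rewrite !map_mxM -sadj_conj Pr ?Ar.
by rewrite !sadjM sadjK As -scalemxAl -scalemxAr mulmxA.
Qed.

Lemma scale_comm (a b : R[i]) k l (M : 'M[R[i]]_(k, l)) :
  a *: (b *: M) = b *: (a *: M).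
Proof. by rewrite !scalerA mulrC. Qed.

Lemma scale_half k l (M : 'M[R[i]]_(k, l)) : (2^-1)%:C *: (M + M) = M.
Proof.
rewrite -mulr2n -scaler_nat scalerA -(rmorph_nat (@real_complex R)) -rmorphM.
by rewrite mulVf ?pnatr_eq0 // scale1r.
Qed.

Lemma factor_half (mu : R) j k (P : 'M[R[i]]_(j, k)) (N : 'M[R[i]]_j)
    (Z1 Z2 : 'M[R[i]]_k) :
  N = mu%:C *: (P *m Z1 *m sadj h P) -> N = mu%:C *: (P *m Z2 *m sadj h P) ->
  N = mu%:C *: (P *m ((2^-1)%:C *: (Z1 + Z2)) *m sadj h P).
Proof.
move=> N1 N2; rewrite -scalemxAr -scalemxAl scale_comm.
by rewrite mulmxDr mulmxDl scalerDr -N1 -N2 scale_half.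
Qed.

(* The factorization is unchanged when Z is averaged over the symmetries
   defining the class. *)
Lemma struct_contraction (mu : R) j k (P : 'M[R[i]]_(j, k)) (N : 'M[R[i]]_j)
    (Z : 'M[R[i]]_k) :
  e * e = 1 -> (rl -> map_mx Num.conj P = P) -> class N ->
  opbound 1 Z -> N = mu%:C *: (P *m Z *m sadj h P) ->
  exists Z', [/\ class Z', opbound 1 Z' & N = mu%:C *: (P *m Z' *m sadj h P)].
Proof.
move=> ee Pr [Nr Ns] hZ NE.
have eeZ k' l (M : 'M[R[i]]_(k', l)) : e%:C *: (e%:C *: M) = M.
  by rewrite scalerA -rmorphM ee scale1r.
(* First average over the adjoint: since [N] is in the class, [e sadj Z] is a parameter for the same
   [N]. *)
have [Z1 [Z1s hZ1 N1]] : exists Z1, [/\ sadj h Z1 = e%:C *: Z1, opbound 1 Z1 &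
    N = mu%:C *: (P *m Z1 *m sadj h P)].
  exists ((2^-1)%:C *: (Z + e%:C *: sadj h Z)); split.
  - rewrite sadjZ sadjD sadjZ sadjK [RHS]scale_comm.
    by congr (_ *: _); rewrite scalerDr eeZ addrC.
  - apply: (opbound_half hZ) => x; rewrite -scalemxAl fro2Z expr2 ee mul1r.
    exact: (opbound_sadj h hZ).
  apply: (factor_half NE); rewrite -[LHS]eeZ -Ns NE sadjZ !sadjM sadjK.
  rewrite -scalemxAr -scalemxAl [LHS]scale_comm.
  by rewrite mulmxA.
case: (boolP rl) Pr Nr => [_ Pr /(_ isT) Nr|r0 _ _]; last first.
  by exists Z1; split=> //; split=> // r1; rewrite r1 in r0.
(* In the real case, a second average, with the conjugate, keeps the symmetry already obtained. *)
exists ((2^-1)%:C *: (Z1 + map_mx Num.conj Z1)); split.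
- split=> [_|].
    by rewrite map_mxZ /= conjCr map_mxD conjMK addrC.
  rewrite sadjZ sadjD sadj_conj Z1s map_mxZ /= conjCr -scalerDr.
  exact: scale_comm.
- exact: opbound_half hZ1 (opbound_conj hZ1).
apply: (factor_half N1); rewrite -Nr N1 map_mxZ /= conjCr !map_mxM.
by rewrite -sadj_conj (Pr isT).
Qed.

End StructClass.

Lemma fro2_isometryl a b c (W : 'M[R[i]]_(a, b)) (M : 'M[R[i]]_(b, c)) :
  W^H *m W = 1%:M -> fro2 (W *m M) = fro2 M.
Proof. by move=> WW; rewrite /fro2 redot_mull mulmxA WW mul1mx. Qed.

Lemma fro2_isometryr a b c (W : 'M[R[i]]_(c, b)) (M : 'M[R[i]]_(a, b)) :
  W^H *m W = 1%:M -> fro2 (M *m W^H) = fro2 M.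
Proof.
by move=> WW; rewrite -(fro2_sadj true) sadjM sadjK fro2_isometryl ?fro2_sadj.
Qed.

Lemma opbound_isometry c k l (W : 'M[R[i]]_(l, k)) (U : 'M[R[i]]_(l, k))
    (M : 'M[R[i]]_k) :
  W^H *m W = 1%:M -> U^H *m U = 1%:M -> U *m U^H = 1%:M ->
  opbound c (W *m M *m U^H) <-> opbound c M.
Proof.
move=> WW UU UU'; split=> hM x.
  have := hM (U *m x).
  by rewrite -!mulmxA (mulmxA U^H) UU mul1mx (fro2_isometryl _ WW) (fro2_isometryl _ UU).
rewrite -!mulmxA (fro2_isometryl _ WW); have := hM (U^H *m x).
by rewrite (@fro2_isometryl _ _ _ U^H) ?sadjK.
Qed.

(** * The Procrustes problem in singular-vector coordinates *)

Section Blocks.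
Variables (h rl : bool) (e : R) (n p r m : nat).
Hypothesis ee : e * e = 1.
Variables (U1 : 'M[R[i]]_(n, r)) (U2 : 'M[R[i]]_(n, m)) (V1 : 'M[R[i]]_(p, r)).
Variables (sd : 'I_r -> R) (X B : 'M[R[i]]_(n, p)).
Hypothesis sd0 : forall i, 0 < sd i.
Hypotheses (U11 : U1^H *m U1 = 1%:M) (U22 : U2^H *m U2 = 1%:M).
Hypotheses (U12 : U1^H *m U2 = 0) (UU : U1 *m U1^H + U2 *m U2^H = 1%:M).
Hypothesis V11 : V1^H *m V1 = 1%:M.
Local Notation S1 := (rdiag sd).
Hypothesis XE : X = U1 *m S1 *m V1^H.

Local Notation S1' := (rdiag (fun i => (sd i)^-1)).

Lemma sdK : S1 *m S1' = 1%:M.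
Proof.
rewrite rdiag_mul; apply/matrixP => i j; rewrite !mxE.
by case: eqP => // _; rewrite mulfV ?gt_eqF.
Qed.

Lemma sdK' : S1' *m S1 = 1%:M.
Proof. exact: mulmx1C sdK. Qed.

Lemma invmx_rdiag : invmx S1 = S1'.
Proof.
have u : S1 \in unitmx by case: (mulmx1_unit sdK).
by rewrite -[LHS]mulmx1 -sdK mulmxA mulVmx // mul1mx.
Qed.

Lemma mpinv_svd : mpinv X = V1 *m S1' *m U1^H.
Proof.
apply: mpinv_eq.
have e1 : X *m (V1 *m S1' *m U1^H) = U1 *m U1^H.
  rewrite XE !mulmxA -(mulmxA _ V1^H) V11 mulmx1 -(mulmxA U1) sdK mulmx1.
  by [].
have e2 : V1 *m S1' *m U1^H *m X = V1 *m V1^H.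
  rewrite XE !mulmxA -(mulmxA _ U1^H) U11 mulmx1 -(mulmxA V1) sdK' mulmx1.
  by [].
rewrite /is_mpinv -!sadjCE e1 e2; split.
- by rewrite XE !mulmxA -(mulmxA _ U1^H) U11 mulmx1.
- by rewrite !mulmxA -(mulmxA _ V1^H) V11 mulmx1.
- by rewrite sadjM sadjK.
- by rewrite sadjM sadjK.
Qed.

Lemma coprojE : coproj X = U2 *m U2^H.
Proof.
rewrite /coproj mpinv_svd XE !mulmxA -(mulmxA _ V1^H) V11 mulmx1.
by rewrite -(mulmxA U1) sdK mulmx1 -UU addrC addKr.
Qed.

(** The left bases: the conjugates of [U1], [U2] for the transpose, and [U1], [U2] themselves for
    Herm. Then [sadj h W2 = U2^H], so that [W2 D U2^H] inherits the symmetry of [D]. *)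
Variables (W1 : 'M[R[i]]_(n, r)) (W2 : 'M[R[i]]_(n, m)).
Hypotheses (W1E : W1 = (sadj h U1)^H) (W2E : W2 = (sadj h U2)^H).

Let W1H : W1^H = sadj h U1. Proof. by rewrite W1E sadjK. Qed.
Let W2H : W2^H = sadj h U2. Proof. by rewrite W2E sadjK. Qed.
Let sW1 : sadj h W1 = U1^H. Proof. by rewrite W1E -sadj_sadjC sadjK. Qed.
Let sW2 : sadj h W2 = U2^H. Proof. by rewrite W2E -sadj_sadjC sadjK. Qed.
Let sU1 : sadj h U1^H = W1. Proof. by rewrite W1E sadj_sadjC. Qed.
Let sU2 : sadj h U2^H = W2. Proof. by rewrite W2E sadj_sadjC. Qed.
Let W11 : W1^H *m W1 = 1%:M.
Proof. by rewrite W1H -sU1 -sadjM U11 sadj1. Qed.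
Let W22 : W2^H *m W2 = 1%:M.
Proof. by rewrite W2H -sU2 -sadjM U22 sadj1. Qed.
Let U21 : U2^H *m U1 = 0.
Proof. by have := congr1 (@sadj _ true _ _) U12; rewrite sadjM sadjK sadj0. Qed.
Let W21 : W2^H *m W1 = 0.
Proof. by rewrite W2H -sU1 -sadjM U12 sadj0. Qed.
Let W12 : W1^H *m W2 = 0.
Proof. by rewrite W1H -sU2 -sadjM U21 sadj0. Qed.
Let WW : W1 *m W1^H + W2 *m W2^H = 1%:M.
Proof. by rewrite W1H W2H -sU1 -sU2 -!sadjM -sadjD UU sadj1. Qed.

Variable E : 'M[R[i]]_r.
Hypothesis clE : struct_class h rl e E.
Local Notation G := (W1^H *m B *m V1).
Hypothesis normal_eq : E *m S1 *m S1 + S1 *m S1 *m E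
  = G *m S1 + e%:C *: (S1 *m sadj h G).
Variable C : 'M[R[i]]_(m, r).
Hypothesis CE : C = W2^H *m B *m V1 *m S1'.

Hypothesis realdata : rl -> [/\ map_mx Num.conj U1 = U1,
  map_mx Num.conj U2 = U2, map_mx Num.conj V1 = V1 & map_mx Num.conj B = B].

Let C_real : rl -> map_mx Num.conj C = C.
Proof.
move=> r1; have [_ c2 c3 c4] := realdata r1.
rewrite CE !map_mxM W2H -!sadj_conj c2 c3 c4; congr (_ *m _).
by rewrite conj_sadj !rdiag_sadj.
Qed.

(* In the bases (W1, W2) and (U1, U2) the solutions of the Procrustes problem
   are the matrices with this block form, where D ranges over the class. *)
Definition assemble (D : 'M[R[i]]_m) : 'M[R[i]]_n :=
  row_mx W1 W2 *m block_mx E (e%:C *: sadj h C) C D *m (row_mx U1 U2)^H.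

Lemma assembleE D : assemble D = W1 *m E *m U1^H + W2 *m C *m U1^H
   + (e%:C *: (W1 *m sadj h C *m U2^H) + W2 *m D *m U2^H).
Proof.
rewrite /assemble sadj_row_mx mul_row_block mul_row_col !mulmxDl.
by rewrite -scalemxAr -scalemxAl.
Qed.

Lemma assemble_def D : assemble D =
  row_mx W1 W2 *m block_mx E (e%:C *: sadj h C) C D *m (row_mx U1 U2)^H.
Proof. by []. Qed.

Opaque assemble.

Lemma eeZ k l (M : 'M[R[i]]_(k, l)) : e%:C *: (e%:C *: M) = M.
Proof. by rewrite scalerA -rmorphM ee scale1r. Qed.

Lemma assemble_class D : struct_class h rl e D -> struct_class h rl e (assemble D).
Proof.
case: clE => Er Es [Dr Ds]; split; last first.
  rewrite assembleE !sadjD sadjZ !sadjM !sadjK sW1 sW2 sU1 sU2 Es Ds.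
  rewrite !scalerDr eeZ -!scalemxAl -!scalemxAr !mulmxA.
  by rewrite -!addrA; congr (_ + _); rewrite addrCA.
move=> r1; have [c1 c2 c3 c4] := realdata r1.
have cW1 : map_mx Num.conj W1 = W1 by rewrite W1E -!sadj_conj c1.
have cW2 : map_mx Num.conj W2 = W2 by rewrite W2E -!sadj_conj c2.
have cC := C_real r1.
rewrite assembleE !map_mxD map_mxZ !map_mxM -!sadj_conj c1 c2 cW1 cW2 cC.
by rewrite (Er r1) (Dr r1) /= conjCr.
Qed.

Local Notation F := (assemble 0).

Lemma assemble_mulU1 D : assemble D *m U1 = W1 *m E + W2 *m C.
Proof.
rewrite assembleE !mulmxDl -!scalemxAl -!mulmxA U11 U21 !mulmx1 !mulmx0.
by rewrite scaler0 !addr0.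
Qed.

Lemma assemble_mulU2 D :
  assemble D *m U2 = e%:C *: (W1 *m sadj h C) + W2 *m D.
Proof.
rewrite assembleE !mulmxDl -!scalemxAl -!mulmxA U12 U22 !mulmx1 !mulmx0.
by rewrite !add0r.
Qed.

(** Move [X] across to get [<H, T>] with [T = (F X - B) X^H]. The normal equation says that [T] has
    the symmetry opposite to that of the class, hence [<H, T> = - <H, T>]. *)
Lemma redot_residual (H : 'M[R[i]]_n) : sadj h H = e%:C *: H ->
  redot (H *m X) (F *m X - B) = 0.
Proof.
move=> Hs; rewrite redot_mulr; set T := (_ - _) *m _.
have TE : T = W1 *m ((E *m S1 - G) *m S1) *m U1^H.
  have -> : T = (F *m U1 *m S1 - B *m V1) *m S1 *m U1^H.
    rewrite /T mulmxBl mulmxBl mulmxBl XE !sadjM rdiag_sadj sadjK !mulmxA.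
    by rewrite -(mulmxA _ V1^H) V11 mulmx1.
  congr (_ *m _); rewrite !mulmxA; congr (_ *m _).
  (* The component along [W2] cancels because [C S1 = W2^H B V1]. *)
  rewrite assemble_mulU1 -{1}[B]mul1mx -WW !mulmxBr !mulmxDl CE.
  rewrite -!mulmxA sdK' mulmx1 opprD addrACA subrr addr0.
  by rewrite !mulmxA.
have YE : e%:C *: sadj h ((E *m S1 - G) *m S1) = - ((E *m S1 - G) *m S1).
  rewrite !sadjM sadjB sadjM !rdiag_sadj clE.2 mulmxBl mulmxBr scalerBr.
  rewrite -!scalemxAr eeZ opprB mulmxA; apply/eqP.
  by rewrite subr_eq addrAC eq_sym subr_eq -normal_eq addrC.
have Te : e%:C *: sadj h T = - T.
  rewrite TE !sadjM sU1 sW1 -sadjM scalemxAr scalemxAl YE.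
  by rewrite mulNmx mulmxN mulmxA.
have : redot H T = - redot H T.
  rewrite -redotNr -Te redotZr -(redot_sadj h H (sadj h T)) sadjK Hs redotZl.
  by rewrite mulrA ee mul1r.
by move=> /eqP; rewrite -addr_eq0 -mulr2n mulrn_eq0 => /eqP.
Qed.

Variables (K : scalars) (S : structure).
Hypothesis in_classP : forall k (A : 'M[R[i]]_k),
  in_class K S A <-> struct_class h rl e A.

Lemma assemble_add D : assemble D = F + W2 *m D *m U2^H.
Proof. by rewrite !assembleE mulmx0 mul0mx addr0 -!addrA. Qed.

Lemma fro2_residual A : struct_class h rl e A ->
  fro2 (A *m X - B) = fro2 (F *m X - B) + fro2 ((A - F) *m X).
Proof.
move=> [_ As]; have -> : A *m X - B = (F *m X - B) + (A - F) *m X.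
  by rewrite mulmxBl [RHS]addrC subrKA.
rewrite fro2D redotC redot_residual ?mulr0 ?addr0 // sadjB As scalerBr.
by have [_ ->] := assemble_class (struct_class0 h rl e m).
Qed.

Lemma rho_svd : rho K S X B = fro_norm (F *m X - B).
Proof.
apply: inf_min.
  by exists F => //=; apply/in_classP/assemble_class/struct_class0.
move=> _ [A /= /in_classP clA <-]; rewrite !fro_normE ler_wsqrtr //.
by rewrite (fro2_residual clA) lerDl fro2_ge0.
Qed.

(** By the Pythagorean identity [fro2_residual], minimality of [A] means [(A - F) X = 0]. Then
    [H = A - F] kills [U1], and by symmetry [W1^H H = 0], so only the block of [H] between [W2] and
    [U2] survives. *)
Lemma procrustes_solP A : procrustes_sol K S X B A <->
  exists2 D, struct_class h rl e D & A = assemble D.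
Proof.
have clF := assemble_class (struct_class0 h rl e m).
split=> [[/in_classP clA]|[D clD ->]]; last first.
  split; first exact/in_classP/assemble_class.
  have DX : (assemble D - F) *m X = 0.
    by rewrite XE !mulmxA mulmxBl !assemble_mulU1 subrr !mul0mx.
  rewrite rho_svd [LHS]fro_normE (fro2_residual (assemble_class clD)) DX.
  by rewrite fro2_0 addr0 -fro_normE.
rewrite rho_svd => /(congr1 (fun x => x ^+ 2)).
rewrite !fro_norm2 (fro2_residual clA).
move=> /eqP; rewrite addrC -subr_eq0 addrK => /eqP /fro2_eq0.
set H := A - F => HX.
have HU : H *m U1 = 0.
  have <- : H *m X *m V1 *m S1' = H *m U1.
    by rewrite XE !mulmxA -(mulmxA _ V1^H) V11 mulmx1 -(mulmxA _ S1) sdK mulmx1.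
  by rewrite HX !mul0mx.
have [_ Hs] : struct_class h rl e H by apply/struct_classD/struct_classN.
have HW : W1^H *m H = 0.
  have := congr1 (@sadj _ h _ _) HU; rewrite sadjM Hs sadj0 -scalemxAr -W1H.
  by move/(congr1 (fun M => e%:C *: M)); rewrite eeZ scaler0.
(* The corresponding block of [F] is zero, so this block of [A] is also that of [H]. *)
exists (W2^H *m A *m U2).
  rewrite W2H -[U2 in _ *m U2](sadjK h); apply: struct_class_congr => // r1.
  by rewrite -sadj_conj; have [_ -> _ _] := realdata r1.
rewrite assemble_add -[LHS](subrK F) -/H addrC; congr (_ + _).
have -> : W2^H *m A *m U2 = W2^H *m H *m U2.
  rewrite mulmxBr mulmxBl -(mulmxA _ F) assemble_mulU2 mulmx0 addr0.
  by rewrite -scalemxAr mulmxA W21 mul0mx scaler0 subr0.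
rewrite !mulmxA -[LHS]mul1mx -WW mulmxDl -mulmxA HW mulmx0 add0r.
rewrite -[LHS]mulmx1 -UU mulmxDr !mulmxA -!(mulmxA _ H) HU !mulmx0 !mul0mx add0r.
by rewrite !mulmxA.
Qed.

Let Wr_iso : (row_mx W1 W2)^H *m row_mx W1 W2 = 1%:M.
Proof. by rewrite sadj_row_mx mul_col_row W11 W12 W21 W22 -scalar_mx_block. Qed.

Let Ur_iso : (row_mx U1 U2)^H *m row_mx U1 U2 = 1%:M.
Proof. by rewrite sadj_row_mx mul_col_row U11 U12 U21 U22 -scalar_mx_block. Qed.

Let Ur_co : row_mx U1 U2 *m (row_mx U1 U2)^H = 1%:M.
Proof. by rewrite sadj_row_mx mul_row_col. Qed.

Lemma fro2_assemble D : fro2 (assemble D) = fro2 E + 2 * fro2 C + fro2 D.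
Proof.
rewrite assemble_def -mulmxA fro2_isometryl // fro2_isometryr //.
rewrite block_mxEv fro2_col_mx !fro2_row_mx fro2Z expr2 ee mul1r fro2_sadj.
by move: (fro2 E) (fro2 C) (fro2 D) => *; ring.
Qed.

Lemma sigma_fro : sigma K S (@fro_norm R n n) X B
  = Num.sqrt (fro_norm E ^+ 2 + 2 * fro_norm C ^+ 2).
Proof.
rewrite !fro_norm2; apply: inf_min.
  exists F; last by rewrite fro_normE fro2_assemble fro2_0 addr0.
  by apply/procrustes_solP; exists 0 => //; apply: struct_class0.
move=> _ [_ /= /procrustes_solP[D _ ->] <-].
by rewrite fro_normE fro2_assemble ler_wsqrtr // lerDl fro2_ge0.
Qed.

Lemma unique_min_fro : unique (fun A => procrustes_sol K S X B A /\
  fro_norm A = sigma K S (@fro_norm R n n) X B) F.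
Proof.
rewrite sigma_fro !fro_norm2; split=> [|_ [/procrustes_solP[D _ ->]]].
  split; last by rewrite fro_normE fro2_assemble fro2_0 addr0.
  by apply/procrustes_solP; exists 0 => //; apply: struct_class0.
rewrite fro_normE fro2_assemble => /(congr1 (fun x => x ^+ 2)).
have c0 : 0 <= fro2 E + 2 * fro2 C by rewrite addr_ge0 ?mulr_ge0 ?fro2_ge0.
have cD := addr_ge0 c0 (fro2_ge0 D).
rewrite (sqr_sqrtr cD) (sqr_sqrtr c0) => /eqP.
by rewrite addrC -subr_eq0 addrK => /eqP /fro2_eq0 ->.
Qed.

Variable mu : R.
Hypothesis muE : mu = spec_norm (col_mx E C).
Local Notation M := ((mu ^+ 2)%:C%:M - E^H *m E).
Variables (Q : 'M[R[i]]_r) (k : 'M[R[i]]_(m, r)) (P : 'M[R[i]]_m).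
Hypotheses (QE : Q = psd_sqrt M) (kE : k = C *m mpinv Q).
Hypothesis PE : P = psd_sqrt (1%:M - k *m k^H).
(** The term [k E^H L] of Parrott's parametrization, for [L = e sadj k]. *)
Local Notation N0 := (e%:C *: (k *m E^H *m sadj h k)).

Let hcol (x : 'cV[R[i]]_r) : fro2 (E *m x) + fro2 (C *m x) <= mu ^+ 2 * fro2 x.
Proof.
have /(spec_normP _ (spec_norm_ge0 _)) := lexx (spec_norm (col_mx E C)).
by rewrite -muE => /(_ x); rewrite mul_col_mx fro2_col_mx.
Qed.

Lemma psd_defect : psd M.
Proof.
apply/psdP; split; first by rewrite sadjB sadj_scalar sadjM sadjK.
move=> x; rewrite mulmxBl mul_scalar_mx redotDr redotZr redotNr -mulmxA -redot_mull.
have := hcol x; have := fro2_ge0 (C *m x).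
rewrite -/(fro2 _) -/(fro2 _); move: (fro2 _) (fro2 _) (_ * _) => *; lra.
Qed.

Let pQ : psd Q. Proof. by rewrite QE; apply: (psd_sqrtP psd_defect).1. Qed.
Let QQ : Q *m Q = M. Proof. by rewrite QE; apply: (psd_sqrtP psd_defect).2. Qed.
Let Qh : Q^H = Q := ((psdP Q).1 pQ).1.

(** Douglas' lemma applies since the choice of [mu] gives [|C x|^2 <= mu^2 |x|^2 - |E x|^2 = |Q
    x|^2]. *)
Let kC : C = k *m Q /\ opbound 1 k.
Proof.
rewrite kE; apply: contraction_factor => x; rewrite (fro2_defect x Qh QQ).
by rewrite lerBrDr addrC.
Qed.

Lemma psd_defect_k : psd (1%:M - k *m k^H).
Proof.
apply/psdP; split; first by rewrite sadjB sadj1 sadjM sadjK.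
move=> x; rewrite mulmxBl mul1mx redotDr redotNr -mulmxA -[k in k *m _](sadjK true).
rewrite -redot_mull subr_ge0.
by have := opbound_sadj true kC.2 x; rewrite expr1n mul1r.
Qed.

Let pP : psd P.
Proof. by rewrite PE; apply: (psd_sqrtP psd_defect_k).1. Qed.
Let PP : P *m P = 1%:M - k *m k^H.
Proof. by rewrite PE; apply: (psd_sqrtP psd_defect_k).2. Qed.
Let Ph : P^H = P := ((psdP P).1 pP).1.

Let k_real : rl -> map_mx Num.conj k = k.
Proof.
move=> r1; rewrite kE map_mxM (C_real r1) QE -mpinv_conj -psd_sqrt_conj; last exact: psd_defect.
rewrite map_mxB map_mxM -sadj_conj (clE.1 r1) map_scalar_mx /=.
by rewrite conjCr.
Qed.

Let P_real : rl -> map_mx Num.conj P = P.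
Proof.
move=> r1; rewrite PE -psd_sqrt_conj; last exact: psd_defect_k.
by rewrite map_mxB map_mxM -sadj_conj (k_real r1) map_mx1.
Qed.

Let clN0 : struct_class h rl e N0.
Proof.
apply/struct_classZ/struct_class_congr => //.
case: clE => Er Es; split=> [r1|]; first by rewrite -sadj_conj Er.
by rewrite sadj_sadjC Es sadjZ.
Qed.

(** Parrott's data for the upper right corner are obtained through [sadj]: [Q' = sadj Q],
    [L = e sadj k], [P2 = sadj P]. As [D + N0] is in the class, [struct_contraction] makes the
    parameter structured. *)
Lemma completion D : struct_class h rl e D ->
  opbound mu (block_mx E (e%:C *: sadj h C) C D) <->
  exists Z, [/\ struct_class h rl e Z, opbound 1 Z &
    D = mu%:C *: (P *m Z *m sadj h P) - N0].
Proof.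
move=> clD.
pose Q' := sadj h Q; pose L := e%:C *: sadj h k.
(* For Hermitian [Q], [mpinv_mulr] gives [Q^+ = Q^+ (Q^+)^H Q], so [k = k0 Q] even when [Q] is
   singular. *)
pose k0 := C *m (mpinv Q *m (mpinv Q)^H); pose L0 := e%:C *: sadj h k0.
have pQ' : psd Q' by apply: psd_sadj.
have QQ' : Q' *m Q' = (mu ^+ 2)%:C%:M - E *m E^H.
  rewrite -sadjM QQ sadjB sadj_scalar sadjM sadj_sadjC clE.2 sadjZ.
  by rewrite -scalemxAl -scalemxAr eeZ.
have kQ : k = k0 *m Q by rewrite /k0 kE {1}mpinv_mulr Qh !mulmxA.
have LE : L = Q' *m L0 by rewrite /L {1}kQ sadjM scalemxAr.
have CL : e%:C *: sadj h C = Q' *m L by rewrite kC.1 sadjM scalemxAr.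
have P2h : (sadj h P)^H = sadj h P by rewrite -sadj_sadjC Ph.
have PP2 : sadj h P *m sadj h P = 1%:M - L^H *m L.
  rewrite -sadjM PP sadjB sadj1 sadjM sadj_sadjC /L sadjZ.
  by rewrite -scalemxAl -scalemxAr eeZ.
have NE : N0 = k *m E^H *m L by rewrite scalemxAr.
have BE : block_mx E (e%:C *: sadj h C) C D = block_mx E (Q' *m L) (k *m Q) D.
  by rewrite CL -kC.1.
rewrite BE NE; split.
  move=> /(parrott_nec pQ pQ' QQ QQ' kQ LE Ph P2h PP PP2)[Z hZ DE].
  have NZ : mu%:C *: (P *m Z *m sadj h P) = D + N0 by rewrite DE NE subrK.
  have [Z' [clZ hZ' ZE]] :=
    struct_contraction ee P_real (struct_classD clD clN0) hZ (esym NZ).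
  by exists Z'; rewrite -ZE -NE addrK.
move=> [Z [_ hZ ->]].
exact: (parrott_suff pQ pQ' QQ QQ' Ph P2h PP PP2).
Qed.

Lemma opbound_assemble c D :
  opbound c (assemble D) <-> opbound c (block_mx E (e%:C *: sadj h C) C D).
Proof. by rewrite assemble_def; apply: opbound_isometry. Qed.

(** Vectors of the form [(x, 0)] see only the first block column, which does not depend on [D]. *)
Lemma mu_le_spec_norm D : mu <= spec_norm (assemble D).
Proof.
rewrite muE; apply/spec_normP; first exact: spec_norm_ge0.
have /(spec_normP _ (spec_norm_ge0 _))/opbound_assemble hD := lexx (spec_norm (assemble D)).
move=> x; have := hD (col_mx x 0); rewrite mul_block_col_fro2 !mulmx0 !addr0.
by rewrite !fro2_col_mx mul_col_mx fro2_col_mx fro2_0 addr0.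
Qed.

Lemma spec_norm_assemble D : struct_class h rl e D ->
  spec_norm (assemble D) <= mu <->
  exists Z, [/\ struct_class h rl e Z, opbound 1 Z &
    D = mu%:C *: (P *m Z *m sadj h P) - N0].
Proof.
move=> clD; rewrite -(completion clD) -opbound_assemble.
by apply: spec_normP; rewrite muE spec_norm_ge0.
Qed.

Lemma sigma_spec : sigma K S (@spec_norm R n n) X B = mu.
Proof.
have clD := struct_classN clN0.
apply: inf_min; last first.
  by move=> _ [_ /= /procrustes_solP[D _ ->] <-]; apply: mu_le_spec_norm.
(* The completion with parameter [Z = 0] attains [mu]. *)
exists (assemble (- N0)).
  by apply/procrustes_solP; exists (- N0).
apply/eqP; rewrite eq_le mu_le_spec_norm andbT; apply/(spec_norm_assemble clD).
exists 0; split; [exact: struct_class0 | exact: opbound0 |].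
by rewrite mulmx0 mul0mx scaler0 add0r.
Qed.

Lemma min_specP A :
  procrustes_sol K S X B A /\ spec_norm A = sigma K S (@spec_norm R n n) X B <->
  exists Z : 'M[R[i]]_m, [/\ in_class K S Z, spec_norm Z <= 1 &
    A = F - W2 *m N0 *m U2^H
        + mu%:C *: (W2 *m P *m Z *m sadj h P *m U2^H)].
Proof.
have WE Z : F - W2 *m N0 *m U2^H + mu%:C *: (W2 *m P *m Z *m sadj h P *m U2^H)
    = assemble (mu%:C *: (P *m Z *m sadj h P) - N0).
  rewrite [RHS]assemble_add mulmxBr mulmxBl -!scalemxAr -!scalemxAl !mulmxA.
  by rewrite -addrA; congr (_ + _); rewrite addrC.
rewrite sigma_spec; split.
  move=> [/procrustes_solP[D clD ->]] hA.
  have /(spec_norm_assemble clD)[Z [clZ hZ DE]] : spec_norm (assemble D) <= mu.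
    by rewrite hA.
  exists Z; split; [exact/in_classP | exact/(spec_normP _ ler01) |].
  by rewrite WE -DE.
move=> [Z [/in_classP clZ /(spec_normP _ ler01) hZ ->]]; rewrite WE.
set D := _ - _; have clD : struct_class h rl e D.
  exact: struct_classD (struct_classZ mu (struct_class_congr P_real clZ)) (struct_classN clN0).
split; first by apply/procrustes_solP; exists D.
apply/eqP; rewrite eq_le mu_le_spec_norm andbT; apply/(spec_norm_assemble clD).
by exists Z.
Qed.

Lemma sadj_coproj : sadj h (coproj X) = W2 *m W2^H.
Proof. by rewrite coprojE sadjM sU2 W2H. Qed.

(** The projections [U2 U2^H] and [W2 W2^H] are [coproj X] and its adjoint; substituting them frees
    the off-diagonal terms from the choice of bases. *)
Lemma assemble0E : assemble 0 = W1 *m E *m U1^H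
  + e%:C *: (sadj h (B *m mpinv X) *m coproj X)
  + sadj h (coproj X) *m B *m mpinv X.
Proof.
rewrite assembleE sadj_coproj coprojE mpinv_svd CE mulmx0 mul0mx addr0.
rewrite addrAC !sadjM sU1 W2H sadjK !mulmxA.
by [].
Qed.

Variable Kx : 'M[R[i]]_(n, r).
Hypothesis KxE : Kx = B *m mpinv X *m U1 *m mpinv Q.

(** This links the matrix K of the theorem with the [k] of the completion problem:
    [B X^+ U1 = B V1 S1^-1] has component [C] along [W2]. *)
Lemma mul_Kx : W2^H *m Kx = C *m mpinv Q.
Proof. by rewrite KxE mpinv_svd CE !mulmxA -(mulmxA _ U1^H) U11 mulmx1. Qed.

Lemma centralE : sadj h (coproj X) *m Kx *m (e%:C *: E^H) *m sadj h Kx *m coproj X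
  = W2 *m N0 *m U2^H.
Proof.
rewrite sadj_coproj coprojE kE -mul_Kx sadjM W2H sadjK.
by rewrite -!scalemxAr -!scalemxAl !mulmxA.
Qed.

End Blocks.
End Core.

(** * The three structures and the blocks of the decomposition *)

Section Instances.
Variable R : realType.

Definition is_herm (S : structure) : bool := if S is Herm then true else false.

Definition struct_sign (S : structure) : R := if S is SkewSym then - 1 else 1.

(** Hermitian matrices stay complex over real scalars, so no reality condition is imposed on
    them. *)
Definition is_real (K : scalars) (S : structure) : bool :=
  if (K, S) is (RealScalars, (Sym | SkewSym)) then true else false.

Lemma struct_sign_sqr S : struct_sign S * struct_sign S = 1.
Proof. by case: S; rewrite /= ?mulrNN mulr1. Qed.

Lemma entries_inP K m n (A : 'M[R[i]]_(m, n)) :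
  entries_in K A <-> (K = RealScalars -> map_mx Num.conj A = A).
Proof.
case: K => /=; last by split.
split=> [Ar _|/(_ erefl) Ar]; first exact: realmxC.
apply/mxOverP => i j; apply/CrealP.
by have /matrixP/(_ i j) := Ar; rewrite mxE.
Qed.

Lemma symmetricmxE n (A : 'M[R[i]]_n) : (A \is symmetricmx) = (A^T == A).
Proof. by rewrite qualifE /= expr0 scale1r map_mx_id // eq_sym. Qed.

Lemma skewmxE n (A : 'M[R[i]]_n) : (A \is skewmx) = (A^T == - A).
Proof.
by rewrite qualifE /= expr1 scaleN1r map_mx_id // eq_sym eqr_oppLR.
Qed.

Lemma in_classP K S n (A : 'M[R[i]]_n) :
  in_class K S A <-> struct_class (is_herm S) (is_real K S) (struct_sign S) A.
Proof.
rewrite /struct_class; case: S => /=.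
- rewrite scale1r sadjE symmetricmxE; split.
    by case/andP => /entries_inP Ar /eqP ->; split=> //; case: K Ar => // Ar _; exact: Ar.
  move=> [Ar As]; apply/andP; split; last exact/eqP.
  by apply/entries_inP; case: K Ar => // Ar _; exact: Ar.
- rewrite rmorphN1 scaleN1r sadjE skewmxE; split.
    by case/andP => /entries_inP Ar /eqP ->; split=> //; case: K Ar => // Ar _; exact: Ar.
  move=> [Ar As]; apply/andP; split; last exact/eqP.
  by apply/entries_inP; case: K Ar => // Ar _; exact: Ar.
rewrite scale1r hermsymmxE; split=> [/eqP Ah|[_ Ah]]; last exact/eqP.
by split=> //; case: K.
Qed.

Lemma sadj_colsub n m k (f : 'I_k -> 'I_n) (A : 'M[R[i]]_(m, n)) :
  (colsub f A)^H = rowsub f A^H.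
Proof. by apply/matrixP => i j; rewrite sadjE !mxE. Qed.

Lemma mulmx_split a b n r (hr : (r <= n)%N) (A : 'M[R[i]]_(a, n))
    (B : 'M[R[i]]_(n, b)) :
  A *m B = first_cols hr A *m rowsub (widen_ord hr) B
    + last_cols hr A *m rowsub (fun j => cast_ord (subnKC hr) (rshift r j)) B.
Proof.
apply/matrixP => i j; rewrite !mxE.
rewrite (reindex (cast_ord (subnKC hr))) /=; last first.
  by exists (cast_ord (esym (subnKC hr))) => k _; rewrite ?cast_ordK ?cast_ordKV.
rewrite big_split_ord /=; congr (_ + _); apply: eq_bigr => k _; rewrite !mxE //.
by congr (A i _ * B _ j); apply: val_inj.
Qed.

Lemma unitary_split n r (hr : (r <= n)%N) (U : 'M[R[i]]_n) :
  U \is unitarymx ->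
  let U1 := first_cols hr U in let U2 := last_cols hr U in
  [/\ U1^H *m U1 = 1%:M, U2^H *m U2 = 1%:M, U1^H *m U2 = 0
    & U1 *m U1^H + U2 *m U2^H = 1%:M].
Proof.
move=> /unitarymxP; rewrite -sadjCE => UU; have UU' := mulmx1C UU.
have sub j k (f : 'I_j -> 'I_n) (g : 'I_k -> 'I_n) :
    (colsub f U)^H *m colsub g U = \matrix_(a, b) (f a == g b)%:R.
  apply/matrixP => a b; have /matrixP/(_ (f a) (g b)) := UU'.
  rewrite !mxE => <-; apply: eq_bigr => c _; congr (_ * _).
    by rewrite sadj_colsub mxE.
  by rewrite mxE.
split; rewrite ?sub; last by rewrite !sadj_colsub -mulmx_split.
- apply/matrixP => a b; rewrite !mxE; congr (nat_of_bool _)%:R.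
- apply/matrixP => a b; rewrite !mxE; congr (nat_of_bool _)%:R.
  by rewrite -!val_eqE /= eqn_add2l.
apply/matrixP => a b; rewrite !mxE -val_eqE /=.
by rewrite ltn_eqF // (leq_trans (ltn_ord a)) ?leq_addr.
Qed.

Lemma svd_split K n p r (hn : (r <= n)%N) (hp : (r <= p)%N)
    (X : 'M[R[i]]_(n, p)) U Sg V : is_svd K r X U Sg V ->
  X = first_cols hn U *m lead_block hn hp Sg *m (first_cols hp V)^H.
Proof.
move=> [_ _ -> Sg0 Sgd]; rewrite -sadjCE -mulmxA (mulmx_split hn U).
(* Rows of [Sg] from index [r] on vanish: off the diagonal by shape, on it because only the first
   [r] singular values are nonzero. *)
have -> : rowsub (fun j => cast_ord (subnKC hn) (rshift r j)) (Sg *m V^H) = 0.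
  apply/matrixP => i j; rewrite !mxE big1 // => k _.
  set i' := cast_ord _ _; have ri' : (r <= i')%N by rewrite leq_addr.
  have [ik|/eqP ik] := eqVneq (i' : nat) k; last by rewrite Sg0 ?mul0r.
  by rewrite (Sgd _ _ ik).2 ?mul0r.
rewrite mulmx0 addr0 -mulmxA; congr (_ *m _).
have -> : rowsub (widen_ord hn) (Sg *m V^H) = rowsub (widen_ord hn) Sg *m V^H.
  by apply/matrixP => i j; rewrite !mxE; apply: eq_bigr => k _; rewrite !mxE.
rewrite (mulmx_split hp).
(* The first [r] rows have no diagonal entry in a column of index at least [r]. *)
have -> : last_cols hp (rowsub (widen_ord hn) Sg) = 0.
  apply/matrixP => i j; rewrite !mxE Sg0 //= => ij.
  by have := ltn_ord i; rewrite ij ltnNge leq_addr.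
rewrite mul0mx addr0 sadj_colsub; congr (_ *m _).
by apply/matrixP => i j; rewrite !mxE.
Qed.

Lemma lead_block_rdiag K n p r (hn : (r <= n)%N) (hp : (r <= p)%N)
    (X : 'M[R[i]]_(n, p)) U Sg V : is_svd K r X U Sg V ->
  exists2 sd, forall i, 0 < sd i & lead_block hn hp Sg = rdiag sd.
Proof.
move=> [_ _ _ Sg0 Sgd].
pose s i := lead_block hn hp Sg i i.
have s0 i : 0 < s i.
  by rewrite /s mxE; apply: (Sgd (widen_ord hn i) (widen_ord hp i) erefl).1 => /=.
exists (fun i => complex.Re (s i)).
  by move=> i; rewrite -ltcR RRe_real // gtr0_real.
apply/matrixP => i j; rewrite !mxE; have [->|ij] := eqVneq i j.
  by rewrite mulr1n RRe_real ?gtr0_real // /s mxE.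
by rewrite mulr0n Sg0 //= => /val_inj /eqP; rewrite (negPf ij).
Qed.

(** * Solving the normal equation entrywise *)

Section NormalEquation.
Variables (h rl : bool) (e : R) (r : nat) (sd : 'I_r -> R).
Hypothesis sd0 : forall i, 0 < sd i.
Variable N : 'M[R[i]]_r.
Local Notation S1 := (rdiag sd).
Local Notation E := (hadamard (Dmx S1) N).

Let d i j : R := (sd i ^+ 2 + sd j ^+ 2)^-1.

Lemma hadamardE i j : E i j = (d i j)%:C * N i j.
Proof.
rewrite !mxE !eqxx !mulr1n -!rmorphXn -rmorphD -fmorphV; congr (_ * _).
Qed.

(** As [S1] is diagonal, the left side multiplies the entry [E i j] by [sd i ^+ 2 + sd j ^+ 2],
    whose inverse is the weight in [Dmx]. *)
Lemma hadamard_normal : E *m S1 *m S1 + S1 *m S1 *m E = N.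
Proof.
have er f i j : (E *m rdiag f) i j = E i j * (f j)%:C.
  by rewrite /rdiag mul_mx_diag !mxE.
have el f i j : (rdiag f *m E) i j = (f i)%:C * E i j.
  by rewrite /rdiag mul_diag_mx !mxE.
apply/matrixP => i j; rewrite -mulmxA rdiag_mul mxE er el hadamardE.
have dE : (d i j)%:C * ((sd j * sd j)%:C + (sd i * sd i)%:C) = 1.
  rewrite -rmorphD -rmorphM -!expr2 addrC mulVf //.
  by rewrite gt_eqF // addr_gt0 // exprn_gt0.
rewrite -[RHS]mul1r -dE.
by move: (d i j)%:C (N i j) (_%:C) (_%:C) => *; ring.
Qed.

(** The weights are real and symmetric in [i] and [j], so the Hadamard product commutes with the
    symmetries of the class. *)
Lemma hadamard_class : struct_class h rl e N -> struct_class h rl e E.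
Proof.
move: hadamardE; move: (hadamard _ _) => E' EE [Nr Ns].
have dC i j : d i j = d j i by rewrite /d addrC.
split=> [r1|]; apply/matrixP => i j.
  have /matrixP/(_ i j) := Nr r1; rewrite !mxE EE rmorphM /= conjCr.
  by move=> ->.
have /matrixP/(_ i j) := Ns; rewrite [RHS]mxE [in X in _ -> X]mxE.
case: h; rewrite !sadjE !mxE !EE (dC j i) mulrCA => <-.
  by rewrite rmorphM /= conjCr.
by [].
Qed.

End NormalEquation.

(** * Uniform formulas for the matrices of the theorem *)

Section Unfold.
Variables (S : structure) (n p r m : nat) (X B : 'M[R[i]]_(n, p)).
Variables (U1 : 'M[R[i]]_(n, r)) (U2 : 'M[R[i]]_(n, m)) (V1 : 'M[R[i]]_(p, r)).
Local Notation h := (is_herm S).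
Local Notation e := (struct_sign S).

Lemma conj_W k l (A : 'M[R[i]]_(k, l)) :
  (sadj h A)^H = if h then A else map_mx Num.conj A.
Proof. by case: h; rewrite ?sadjK ?conj_sadj. Qed.

Lemma EmxE (S1 : 'M[R[i]]_r) : sadj h S1 = S1 ->
  Emx S B U1 V1 S1 = hadamard (Dmx S1) (sadj h U1 *m B *m V1 *m S1
    + e%:C *: (S1 *m sadj h (sadj h U1 *m B *m V1))).
Proof.
case: S => /= S1s; rewrite ?rmorphN1 /ET /EH; congr (hadamard _ (_ + _));
  rewrite ?scale1r !sadjM sadjK !sadjE !mulmxA //.
Qed.

Lemma CmxE (S1 : 'M[R[i]]_r) :
  Cmx S B U2 V1 S1 = sadj h U2 *m B *m V1 *m invmx S1.
Proof. by case: S => /=; rewrite sadjE. Qed.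

Lemma FmxE (E : 'M[R[i]]_r) : Fmx S X B U1 E = (sadj h U1)^H *m E *m U1^H
  + e%:C *: (sadj h (B *m mpinv X) *m coproj X)
  + sadj h (coproj X) *m B *m mpinv X.
Proof.
rewrite conj_W; case: S => /=; rewrite ?rmorphN1 /FT /FH ?scale1r !sadjE //.
Qed.

(** The single expression [e E^H] covers all three cases; it accounts for the sign under the root of
    K in the skew-symmetric one. *)
Lemma conj_structured k (E : 'M[R[i]]_k) : sadj h E = e%:C *: E ->
  (if h then E else map_mx Num.conj E) = e%:C *: E^H.
Proof.
move=> Es; rewrite -conj_W Es sadjZ.
by [].
Qed.

Lemma KmxE (E : 'M[R[i]]_r) mu : sadj h E = e%:C *: E ->
  Kmx S X B U1 E mu = B *m mpinv X *m U1
    *m mpinv (psd_sqrt ((mu ^+ 2)%:C%:M - E^H *m E)).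
Proof.
move=> /conj_structured; case: S => /= EE; rewrite /Kmx.
- by rewrite EE scale1r.
- by rewrite EE rmorphN1 scaleN1r mulNmx.
by rewrite {1}EE scale1r.
Qed.

Lemma centralmxE (E : 'M[R[i]]_r) (K : 'M[R[i]]_(n, r)) : sadj h E = e%:C *: E ->
  central S X E K =
    sadj h (coproj X) *m K *m (e%:C *: E^H) *m sadj h K *m coproj X.
Proof. by move=> /conj_structured <-; case: S; rewrite /= !sadjE. Qed.

Lemma phi_sadj (mu : R) (K : 'M[R[i]]_(n, r)) (Z : 'M[R[i]]_m) :
  phi S mu U2 K Z = mu%:C *: ((sadj h U2)^H
    *m psd_sqrt (1%:M - sadj h U2 *m K *m K^H *m (sadj h U2)^H)
    *m Z *m psd_sqrt (1%:M - U2^H *m (sadj h K)^H *m sadj h K *m U2) *m U2^H).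
Proof. by rewrite !conj_W; case: S; rewrite !sadjE. Qed.

(** Square roots commute with [sadj], so the right root in [phi] is the structured adjoint of the
    left one. *)
Lemma phiE (mu : R) (K : 'M[R[i]]_(n, r)) (Z : 'M[R[i]]_m)
    (W2 : 'M[R[i]]_(n, m)) (k : 'M[R[i]]_(m, r)) (P : 'M[R[i]]_m) :
  W2 = (sadj h U2)^H -> k = W2^H *m K -> P = psd_sqrt (1%:M - k *m k^H) ->
  psd (1%:M - k *m k^H) ->
  phi S mu U2 K Z = mu%:C *: (W2 *m P *m Z *m sadj h P *m U2^H).
Proof.
move=> W2E kE PE pP; rewrite phi_sadj -W2E.
have kk : 1%:M - k *m k^H = 1%:M - sadj h U2 *m K *m K^H *m W2.
  by rewrite kE sadjM sadjK W2E sadjK !mulmxA.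
have sP : sadj h P = psd_sqrt (1%:M - U2^H *m (sadj h K)^H *m sadj h K *m U2).
  rewrite PE -psd_sqrt_sadj // kk W2E sadjB sadj1 !sadjM !sadjK.
  by rewrite !sadj_sadjC !sadjK !mulmxA.
by rewrite -sP -kk -PE.
Qed.

End Unfold.

(** * Both norms for data split into blocks *)

Section Assembly.
Variables (K : scalars) (S : structure) (n p r m : nat).
Variables (X B : 'M[R[i]]_(n, p)) (U1 : 'M[R[i]]_(n, r)) (U2 : 'M[R[i]]_(n, m)).
Variables (V1 : 'M[R[i]]_(p, r)) (sd : 'I_r -> R).
Local Notation h := (is_herm S).
Local Notation rl := (is_real K S).
Local Notation e := (struct_sign S).
Hypothesis sd0 : forall i, 0 < sd i.
Hypotheses (U11 : U1^H *m U1 = 1%:M) (U22 : U2^H *m U2 = 1%:M).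
Hypotheses (U12 : U1^H *m U2 = 0) (UU : U1 *m U1^H + U2 *m U2^H = 1%:M).
Hypotheses (V11 : V1^H *m V1 = 1%:M) (XE : X = U1 *m rdiag sd *m V1^H).
Hypothesis realdata : rl -> [/\ map_mx Num.conj U1 = U1,
  map_mx Num.conj U2 = U2, map_mx Num.conj V1 = V1 & map_mx Num.conj B = B].
Variables (S1 E : 'M[R[i]]_r) (C : 'M[R[i]]_(m, r)) (F : 'M[R[i]]_n) (mu : R).
Variable Kx : 'M[R[i]]_(n, r).
Hypotheses (S1E : rdiag sd = S1) (EE : E = Emx S B U1 V1 S1).
Hypotheses (CE : C = Cmx S B U2 V1 S1) (FE : F = Fmx S X B U1 E).
Hypotheses (muE : mu = spec_norm (col_mx E C)) (KxE : Kx = Kmx S X B U1 E mu).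

Variables (W1 : 'M[R[i]]_(n, r)) (W2 : 'M[R[i]]_(n, m)).
Hypotheses (W1E : W1 = (sadj h U1)^H) (W2E : W2 = (sadj h U2)^H).

Let W1H : W1^H = sadj h U1. Proof. by rewrite W1E sadjK. Qed.
Let W2H : W2^H = sadj h U2. Proof. by rewrite W2E sadjK. Qed.
Let ee : e * e = 1 := struct_sign_sqr S.

Let EN : E = hadamard (Dmx (rdiag sd)) (W1^H *m B *m V1 *m rdiag sd
  + e%:C *: (rdiag sd *m sadj h (W1^H *m B *m V1))).
Proof. by rewrite EE -S1E (EmxE B U1 V1 (rdiag_sadj h sd)) W1H. Qed.

Let clE : struct_class h rl e E.
Proof.
rewrite EN W1H; apply: hadamard_class; split=> [r1|].
  have [c1 _ c3 c4] := realdata r1.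
  have cS : map_mx Num.conj (rdiag sd) = rdiag sd.
    by rewrite conj_sadj !rdiag_sadj.
  have cG : map_mx Num.conj (sadj h U1 *m B *m V1) = sadj h U1 *m B *m V1.
    by rewrite !map_mxM -sadj_conj c1 c3 c4.
  rewrite map_mxD map_mxZ (map_mxM _ (_ *m V1)) (map_mxM _ (rdiag sd)).
  by rewrite -sadj_conj cS cG /= conjCr.
rewrite sadjD sadjZ (sadjM h (_ *m V1)) (sadjM h (rdiag sd)) sadjK rdiag_sadj.
by rewrite scalerDr scalerA -rmorphM ee scale1r addrC.
Qed.

Let normal_eq : E *m rdiag sd *m rdiag sd + rdiag sd *m rdiag sd *m E
  = W1^H *m B *m V1 *m rdiag sd + e%:C *: (rdiag sd *m sadj h (W1^H *m B *m V1)).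
Proof.
have := hadamard_normal sd0 (W1^H *m B *m V1 *m rdiag sd
  + e%:C *: (rdiag sd *m sadj h (W1^H *m B *m V1))).
by rewrite -EN.
Qed.

Let CE' : C = W2^H *m B *m V1 *m rdiag (fun i => (sd i)^-1).
Proof. by rewrite CE CmxE -S1E (invmx_rdiag sd0) W2H. Qed.

Let KxE' : Kx = B *m mpinv X *m U1
  *m mpinv (psd_sqrt ((mu ^+ 2)%:C%:M - E^H *m E)).
Proof. by rewrite KxE (KmxE X B U1 mu clE.2). Qed.

Lemma procrustes_blocks :
  (sigma K S (@fro_norm R n n) X B
     = Num.sqrt (fro_norm E ^+ 2 + 2 * fro_norm C ^+ 2) /\
   unique (fun A : 'M[R[i]]_n => procrustes_sol K S X B A /\
     fro_norm A = sigma K S (@fro_norm R n n) X B) F) /\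
  (sigma K S (@spec_norm R n n) X B = mu /\
   forall A : 'M[R[i]]_n,
     procrustes_sol K S X B A /\
       spec_norm A = sigma K S (@spec_norm R n n) X B <->
     exists Z : 'M[R[i]]_m,
       [/\ in_class K S Z, spec_norm Z <= 1 &
           A = F - central S X E Kx + phi S mu U2 Kx Z]).
Proof.
have clS k (A : 'M[R[i]]_k) : in_class K S A <-> struct_class h rl e A.
  exact: in_classP.
have [k kE] : exists k, k = C *m mpinv (psd_sqrt ((mu ^+ 2)%:C%:M - E^H *m E)).
  by eexists.
have [P PE] : exists P, P = psd_sqrt (1%:M - k *m k^H) by eexists.
have kK : k = W2^H *m Kx by rewrite kE (mul_Kx sd0 U11 V11 XE CE' KxE').
have FE' : F = assemble h e U1 U2 W1 W2 E C 0.
  by rewrite FE FmxE -W1E (assemble0E e sd0 U11 UU V11 XE W1E W2E E CE').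
have centralK : central S X E Kx
    = W2 *m (e%:C *: (k *m E^H *m sadj h k)) *m U2^H.
  rewrite (centralmxE X Kx clE.2).
  exact: (centralE e sd0 U11 UU V11 XE W2E E CE' kE KxE').
have pk := psd_defect_k muE erefl kE.
have phiK Z : phi S mu U2 Kx Z = mu%:C *: (W2 *m P *m Z *m sadj h P *m U2^H).
  exact: (phiE mu Z W2E kK PE pk).
rewrite FE' centralK; split.
  split; first exact: (sigma_fro ee sd0 U11 U22 U12 UU V11 XE W1E W2E clE
    normal_eq CE' realdata clS).
  exact: (unique_min_fro ee sd0 U11 U22 U12 UU V11 XE W1E W2E clE
    normal_eq CE' realdata clS).
split; first exact: (sigma_spec ee sd0 U11 U22 U12 UU V11 XE W1E W2E clE
  normal_eq CE' realdata clS muE erefl kE PE).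
move=> A; have hA := min_specP ee sd0 U11 U22 U12 UU V11 XE W1E W2E clE
  normal_eq CE' realdata clS muE erefl kE PE A.
split=> [/hA[Z [clZ hZ AE]]|[Z [clZ hZ AE]]].
  by exists Z; split; [exact: clZ | exact: hZ | rewrite phiK].
by apply/hA; exists Z; split; [exact: clZ | exact: hZ | rewrite AE phiK].
Qed.

End Assembly.

End Instances.

(* The minimizers for a given singular value decomposition *)
Local Close Scope complex_scope.
Local Close Scope sesquilinear_scope.

Theorem theorem3p3 (R : realType) (K : scalars) (S : structure) (n p r : nat)
    (X B : 'M[R[i]]_(n, p)) (U : 'M[R[i]]_n) (Sg : 'M[R[i]]_(n, p))
    (V : 'M[R[i]]_p)
    (XK : entries_in K X) (BK : entries_in K B)
    (hr : \rank X = r) (hsvd : is_svd K r X U Sg V) :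
  let hn := mxrank_le_row hr in
  let hp := mxrank_le_col hr in
  let U1 := first_cols hn U in
  let U2 := last_cols hn U in
  let V1 := first_cols hp V in
  let S1 := lead_block hn hp Sg in
  let E := Emx S B U1 V1 S1 in
  let C := Cmx S B U2 V1 S1 in
  let F := Fmx S X B U1 E in
  let sigmaF := sigma K S (@fro_norm R n n) X B in
  let sigma2 := sigma K S (@spec_norm R n n) X B in
  let mu := spec_norm (col_mx E C) in
  let Kx := Kmx S X B U1 E mu in
  (sigmaF = Num.sqrt (fro_norm E ^+ 2 + 2 * fro_norm C ^+ 2) /\
   unique (fun A : 'M[R[i]]_n =>
             procrustes_sol K S X B A /\ fro_norm A = sigmaF) F) /\
  (sigma2 = mu /\
   forall A : 'M[R[i]]_n,
     procrustes_sol K S X B A /\ spec_norm A = sigma2 <->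
     exists Z : 'M[R[i]]_(n - r),
       [/\ in_class K S Z, spec_norm Z <= 1 &
           A = F - central S X E Kx + phi S mu U2 Kx Z]).
Proof.
move=> hn hp U1 U2 V1 S1 E C F sigmaF sigma2 mu Kx.
have [/andP[Ur Uu] /andP[Vr Vu] _ _ _] := hsvd.
have [U11 U22 U12 UU] := unitary_split hn Uu.
have [V11 _ _ _] := unitary_split hp Vu.
have [sd sd0 S1E] := lead_block_rdiag hn hp hsvd.
have XE := svd_split hn hp hsvd; rewrite S1E in XE.
(* Over real scalars all the factors have real entries; over complex ones [is_real] is false. *)
have realdata : is_real K S -> [/\ map_mx Num.conj U1 = U1,
    map_mx Num.conj U2 = U2, map_mx Num.conj V1 = V1 & map_mx Num.conj B = B].
  move: Ur Vr BK; rewrite /U1 /U2 /V1 /is_real; case: (K); last by case: (S).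
  move=> /entries_inP/(_ erefl) Ur /entries_inP/(_ erefl) Vr.
  move=> /entries_inP/(_ erefl) Br _.
  by rewrite /first_cols /last_cols !map_mxsub Ur Vr Br.
exact: (procrustes_blocks sd0 U11 U22 U12 UU V11 XE realdata (esym S1E)
  erefl erefl erefl erefl erefl erefl erefl).
Qed.
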